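(* Let $f(x)=x^2+bx+c\in\mathbb{Z}[x]$ be irreducible with $2\nmid b$. For $n\ge1$ let $f^n$ be the $n$-fold iterate of $f$, $K_n$ the number field generated by a root of $f^n$, and $\mathcal{O}_{K_n}$ its ring of integers. (1) Suppose $2\nmid c$. Let $2^m$ be the smallest power of $2$ greater than $n$, so $2^{m-1}\le n<2^m$. Then $$2\mathcal{O}_{K_n}=\prod_{i=1}^{2^{n-m}}\mathfrak{p}_i,$$ where the $\mathfrak{p}_i$ are distinct prime ideals of $\mathcal{O}_{K_n}$, each with residue class degree $[\mathcal{O}_{K_n}/\mathfrak{p}_i:\mathbb{F}_2]=2^m$. (2) Suppose $2\mid c$ and $n>1$. Let $2^m$ be the smallest power of $2$ greater than $n-1$, so $2^{m-1}<n\le 2^m$. Then $$2\mathcal{O}_{K_n}=\mathfrak{p}_{0,1}\,\mathfrak{p}_{0,2}\ \prod_{r=1}^{m-1}\left(\prod_{i=1}^{2^{2^r-r}-2^{2^{r-1}-r}}\mathfrak{p}_{r,i}\right)\ \prod_{j=2^{m-1}}^{n-1}\left(\prod_{i=1}^{2^{j-m}}\mathfrak{p}_{m,j,i}\right),$$ where all the prime ideals appearing are distinct, $[\mathcal{O}_{K_n}/\mathfrak{p}_{r,i}:\mathbb{F}_2]=2^r$ for $0\le r\le m-1$, and $[\mathcal{O}_{K_n}/\mathfrak{p}_{m,j,i}:\mathbb{F}_2]=2^m$.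
   Context: The $n$-fold iterate is $f^n=f\circ\cdots\circ f$ ($n$ copies of $f$). Empty products equal the unit ideal.
   Formalization: Part (1) additionally assumes that f^n is irreducible: without this it fails, e.g. for f = x^2-x-1 and n = 3, where f^3 splits into two quartics, so K_3 has degree at most 4 while the conclusion forces degree 8. *)

(* Defs.v *)
From HB Require Import structures.
From mathcomp Require Import all_boot all_order all_algebra all_field.
From mathcomp Require Import boolp classical_sets.
Set Implicit Arguments.
Unset Strict Implicit.
Unset Printing Implicit Defensive.
Import GRing.Theory.
Local Open Scope ring_scope.
Local Open Scope classical_set_scope.

(* [irreducible_poly] at {poly int} is defined by pseudo-division, hence blind
   to constant factors; this is irreducibility in the ring itself. *)
Definition irreducible_in (R : unitRingType) (x : R) : Prop :=
  [/\ x != 0, x \isn't a GRing.unit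
    & forall y z : R, x = y * z ->
        y \is a GRing.unit \/ z \is a GRing.unit].

(* Irreducibility of f does not pass to its iterates: for f = X^2 - X - 1,
   the third iterate is
   (X^4 - 3 X^3 + 4 X - 1) (X^4 - X^3 - 3 X^2 + X + 1). *)
Definition iter_poly (R : nzRingType) (n : nat) (f : {poly R}) : {poly R} :=
  iter n (fun g => f \Po g) 'X.

Section RingOfIntegers.
Variable K : fieldExtType rat.

Definition integral_over_int : {pred K} :=
  fun x => `[< integralOver (intr : int -> K) x >].

Lemma integral_over_intP x :
  reflect (integralOver (intr : int -> K) x) (x \in integral_over_int).
Proof. exact: asboolP. Qed.

Lemma integral_over_int_subring : subring_closed integral_over_int.
Proof.
split=> [|x y /integral_over_intP Zx /integral_over_intP Zy
         |x y /integral_over_intP Zx /integral_over_intP Zy];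
  apply/integral_over_intP.
- exact: integral1.
- exact: integral_sub.
- exact: integral_mul.
Qed.

HB.instance Definition _ :=
  GRing.isSubringClosed.Build K integral_over_int integral_over_int_subring.

Record ring_of_integers := RingOfIntegers {
  oval : K; _ : oval \in integral_over_int }.

HB.instance Definition _ := [isSub for oval].
HB.instance Definition _ := [Choice of ring_of_integers by <:].
HB.instance Definition _ :=
  [SubChoice_isSubComNzRing of ring_of_integers by <:].
End RingOfIntegers.

(* Ideals enter products as sets of elements, because [idealr] covers only
   proper ideals while the empty product is the unit ideal [setT]. *)
Section Ideals.
Variable R : comNzRingType.

Definition ideal_set (P : idealr R) : set R := [set x | x \in P].

Definition principal_ideal (a : R) : set R := [set a * x | x in setT].

Definition ideal_mul (I J : set R) : set R :=
  [set x | exists2 s : seq (R * R),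
     (forall u, u \in s -> I u.1 /\ J u.2) & x = \sum_(u <- s) u.1 * u.2].

(* [R / P : F_l] = d; the F_l-module structure on R / P comes from its being
   a ring of characteristic l. *)
Definition residue_degree (P : idealr R) (l d : nat) : Prop :=
  exists (charP : l \in [pchar {ideal_quot P}])
         (phi : {linear pPrimeCharType charP -> 'rV['F_l]_d}), bijective phi.
End Ideals.

Definition least_pow2_gt (k m : nat) : Prop :=
  (k < 2 ^ m)%N /\ forall j : nat, (k < 2 ^ j)%N -> (2 ^ m <= 2 ^ j)%N.

(* Main.v *)
Require Import Defs.
From HB Require Import structures.
From mathcomp Require Import all_boot all_order all_algebra all_field.
From mathcomp Require Import boolp classical_sets.
From mathcomp Require Import zify ring.
Import GRing.Theory.
Local Open Scope ring_scope.

(** Write [g] for the [n]-th iterate of [f], [alpha] for its root, [O] for the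
    ring of integers of [K], and [theta] for a root of [g] modulo 2.

    Since [b] is odd, [f' = 1] modulo 2, so [g' = 1] modulo 2 by the chain rule:
    [g] is separable modulo 2.  Euler's formula puts [g'(alpha) * O] inside
    [Z[alpha]] ([integral_mul_deriv]), and as [g'(alpha)] is 1 modulo 2 this
    identifies [O / 2] with [F_2[X] / g] ([integer_mod2], [reduction_even]).
    Each root [theta] of [g] in a finite field of characteristic 2 thus gives a
    reduction [O -> F] with [alpha |-> theta] ([exists_reduction]); its kernel
    is a maximal ideal, whose residue field is generated by [theta]
    ([residue_degree_kernel]).  Two roots give the same ideal exactly when they
    are conjugate under Frobenius, and the intersection of all these ideals is
    [2 O] ([primes_above_two]).  Distinct maximal ideals being comaximal, the
    intersection is a product ([ideal_mul_inter]).

    It remains to count Frobenius orbits.  Modulo 2, [f] is [T] or [T + 1] with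
    [T y = y ^ 2 + y], a linear map equal to [frob + 1].  Hence
    [T ^ (2 ^ r) = frob ^ (2 ^ r) + 1]: the degree of [theta] over the prime
    field divides [2 ^ r] if and only if [T ^ (2 ^ r)] kills it.  If [k] is the
    least number of applications of [T] that kill [theta], its depth, then the
    degree of [theta] is the least power of 2 that is at least [k]
    ([frob_order_depth]).  There are [2 ^ k] elements of depth at most [k]
    ([card_depth_le]), which gives the number of orbits in each range of depths
    ([size_depth_reps]).  When [c] is odd, the roots of [g] are the elements of
    depth [n + 1]; when [c] is even, they are those of depth at most [n].

    When [c] is even, irreducibility of [f] passes to [g]
    ([iter_poly_irreducible]): there is always a prime of degree 1 above 2 at
    which [beta = 1] for [beta] a root of the previous iterate, and [f - beta]
    reduces there to [X ^ 2 + X + 1], which has no root in the prime field. *)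

Import Order.TTheory Num.Theory.
Set Implicit Arguments.
Unset Strict Implicit.
Unset Printing Implicit Defensive.

Local Notation pZtoQ := (map_poly (intr : int -> rat)).
Local Notation evZ p x := (map_poly intr p).[x].

(** * Integral elements of a monogenic number field *)

Lemma map_intr_comp (R S : nzRingType) (phi : {rmorphism R -> S}) (p : {poly int}) :
  map_poly phi (map_poly intr p) = map_poly intr p.
Proof. by rewrite -map_poly_comp; apply: eq_map_poly => k /=; rewrite rmorph_int. Qed.

Lemma rmorph_evZ (R S : nzRingType) (phi : {rmorphism R -> S}) (p : {poly int}) x :
  phi (evZ p x) = evZ p (phi x).
Proof. by rewrite -horner_map map_intr_comp. Qed.

Lemma irreducible_dvdp_root (F L : fieldType)
    (iota : {rmorphism F -> L}) (p q : {poly F}) (z : L) :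
  irreducible_poly p -> root (map_poly iota p) z -> root (map_poly iota q) z ->
  p %| q.
Proof.
move=> p_irr pz qz; apply: contraT; rewrite -(irreducible_poly_coprime q p_irr).
rewrite -(coprimep_map iota) => co.
by have := coprimep_root co pz; rewrite (rootP qz) eqxx.
Qed.

Lemma irreducible_separable (p : {poly rat}) :
  irreducible_poly p -> separable_poly p.
Proof.
move=> p_irr; rewrite unlock irreducible_poly_coprime //.
have p0 := irredp_neq0 p_irr; have s1 := p_irr.1.
have d0 : p^`() != 0.
  apply: contraTneq isT => dE.
  have := congr1 (fun q : {poly rat} => q`_((size p).-2)) dE.
  rewrite coef_deriv coef0; case sp: (size p) s1 => [|[|k]] //= _.
  move/eqP; rewrite mulrn_eq0 /=.
  have -> : p`_k.+1 = lead_coef p by rewrite lead_coefE sp.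
  by rewrite lead_coef_eq0 (negPf p0).
by apply/negP => /(dvdp_leq d0); rewrite leqNgt lt_size_deriv.
Qed.

(** Lagrange interpolation: the remainder of [s * g'] takes the value
    [s z * g' z] at each complex root [z] of [g], so it equals the sum of the
    [s z * g / ('X - z)], whose coefficients are algebraic integers as soon as
    all the conjugates [s z] are; being rational, they are integers. *)
Lemma euler_remainder_int (g q : {poly int}) (s : {poly rat}) :
    g \is monic -> separable_poly (pZtoQ g) -> q \is monic ->
    pZtoQ g %| pZtoQ q \Po s ->
  exists r : {poly int}, (s * (pZtoQ g)^`()) %% pZtoQ g = pZtoQ r.
Proof.
move=> g_mon g_sep q_mon g_dvd.
set G := pZtoQ g in g_sep g_dvd *; set R0 := (s * _) %% _.
have G_mon : G \is monic by rewrite monic_map.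
pose toC := map_poly (ratr : rat -> algC).
have [rs] := closed_field_poly_normal (toC G).
have GC_mon : toC G \is monic by rewrite monic_map.
rewrite (monicP GC_mon) scale1r => GE.
have rs_uniq : uniq rs by rewrite -separable_prod_XsubC -GE separable_map.
have toC_int p : toC (pZtoQ p) = map_poly intr p.
  by rewrite /toC -map_poly_comp; apply: eq_map_poly => k /=; rewrite ratr_int.
have Groot z : z \in rs -> root (toC G) z.
  by rewrite GE root_prod_XsubC.
have rootAint z : z \in rs -> z \in Aint.
  move=> zrs; apply: (root_monic_Aint (Groot z zrs) GC_mon).
  by rewrite toC_int; apply/polyOverP => i; rewrite coef_map /= intr_int.
have sAint z : z \in rs -> (toC s).[z] \in Aint.
  move=> zrs; apply: (@root_monic_Aint (map_poly intr q)).
  - move: (Groot z zrs) g_dvd => Gz; rewrite -(dvdp_map (ratr : {rmorphism rat -> algC}))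
    => /dvdpP [u uE]; rewrite rootE -toC_int.
    have -> : (toC (pZtoQ q)).[(toC s).[z]] = (toC (pZtoQ q \Po s)).[z].
      by rewrite /toC map_comp_poly horner_comp.
    by rewrite /toC uE hornerM (rootP Gz) mulr0.
  - by rewrite monic_map.
  - by apply/polyOverP => i; rewrite coef_map /= intr_int.
(* [h z] is [g / ('X - z)]. *)
pose h z := \prod_(y <- rs | y != z) ('X - y%:P).
have GhE z : z \in rs -> toC G = ('X - z%:P) * h z.
  by move=> zrs; rewrite GE (bigD1_seq z).
have dG z : z \in rs -> (toC G^`()).[z] = (h z).[z].
  move=> zrs; rewrite /toC -deriv_map -/(toC G) (GhE z zrs) derivM derivXsubC mul1r.
  by rewrite hornerD hornerM !hornerE subrr mul0r addr0.
have h0 y z : z \in rs -> y \in rs -> y != z -> (h z).[y] = 0.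
  move=> zrs yrs yz; rewrite /h -big_filter (bigD1_seq y) /=; last first.
  - exact: filter_uniq.
  - by rewrite mem_filter yz.
  by rewrite hornerM !hornerE subrr mul0r.
pose R1 := \sum_(z <- rs) (toC s).[z] *: h z.
have R1int : R1 \is a polyOver Aint.
  rewrite /R1 big_seq; apply: rpred_sum => z zrs; apply: polyOverZ; first exact: sAint.
  rewrite /h big_seq_cond; apply: rpred_prod => y /andP[yrs _].
  by rewrite polyOverXsubC rootAint.
have sizeG : size (toC G) = (size rs).+1 by rewrite GE size_prod_XsubC.
have R0E : toC R0 = R1.
  apply/eqP; rewrite -subr_eq0; apply/eqP.
  apply: (@roots_geq_poly_eq0 _ _ rs) => //.
    apply/allP => y yrs; rewrite /root hornerD hornerN.
    have -> : (toC R0).[y] = (toC s).[y] * (h y).[y].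
      rewrite -dG // -hornerM -/(toC _) -rmorphM /= [in RHS](divp_eq (s * G^`()) G).
      by rewrite /toC rmorphD rmorphM /= hornerD hornerM (rootP (Groot y yrs)) mulr0 add0r.
    rewrite /R1 horner_sum (bigD1_seq y) //= hornerZ big_seq_cond big1 ?addr0 ?subrr //.
    by move=> z /andP[zrs zy]; rewrite hornerZ h0 ?mulr0 // eq_sym.
  rewrite -ltnS -sizeG; apply: (leq_ltn_trans (size_polyD _ _)).
  rewrite size_polyN gtn_max; apply/andP; split.
    rewrite !size_map_poly ltn_modp; exact: monic_neq0.
  apply: (leq_ltn_trans (size_sum _ _ _)); rewrite big_seq.
  elim/big_ind: _ => [|a b ha hb|z zrs].
  - by rewrite sizeG.
  - by rewrite gtn_max ha.
  - apply: (leq_ltn_trans (size_scale_leq _ _)).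
    rewrite (GhE z zrs) size_monicM ?monicXsubC ?size_XsubC //=.
    by rewrite /h -big_filter; apply/monic_neq0/monic_prod => y _; apply: monicXsubC.
have R0int i : R0`_i \in Num.int.
  have : (ratr R0`_i : algC) \in Num.int.
    apply: Cint_rat_Aint; first exact: Crat_rat.
    by rewrite -coef_map -/(toC R0) R0E (polyOverP R1int).
  case/intrP => k kE; apply/intrP; exists k.
  by apply: (fmorph_inj (ratr : {rmorphism rat -> algC})); rewrite rmorph_int.
exists (map_poly (fun a => Num.floor a) R0); apply/polyP => i.
by rewrite coef_map /= coef_map_id0 ?floor0 ?floorK.
Qed.

Section MonogenicField.
Variables (g : {poly int}) (K : fieldExtType rat) (alpha : K).
Hypotheses (g_mon : g \is monic) (g_irr : irreducible_poly (pZtoQ g)).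
Hypothesis g_alpha : root (map_poly intr g) alpha.

Lemma int_poly_dvd_root (p : {poly int}) :
  evZ p alpha = 0 -> exists q, p = g * q.
Proof.
move=> pa; have : pZtoQ g %| pZtoQ p.
  apply: (@irreducible_dvdp_root _ K (in_alg K) _ _ alpha) => //.
    by rewrite map_intr_comp.
  by rewrite map_intr_comp; apply/rootP.
rewrite dvdp_rat_int => /dvdpP_int [r ->]; exists r.
by rewrite zprimitive_monic.
Qed.

Lemma reduction_well_defined (S : comNzRingType) (theta : S) (p : {poly int}) :
  evZ g theta = 0 -> evZ p alpha = 0 -> evZ p theta = 0.
Proof.
by move=> gt /int_poly_dvd_root [q ->]; rewrite rmorphM hornerM gt mul0r.
Qed.

(** Euler's inclusion of the integral closure of [Z[alpha]] in
    the fractional ideal generated by [1 / g'(alpha)]. *)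
Lemma integral_mul_deriv (x : K) :
    x \in <<1; alpha>>%VS -> integralOver (intr : int -> K) x ->
  exists r : {poly int}, x * evZ g^`() alpha = evZ r alpha.
Proof.
case/Fadjoin_polyP => _ /polyOver1P [s ->] xE [q q_mon qx].
have Ga : root (map_poly (in_alg K) (pZtoQ g)) alpha by rewrite map_intr_comp.
have [||r rE] := @euler_remainder_int g q s g_mon _ q_mon _.
- exact: irreducible_separable.
- apply: (@irreducible_dvdp_root _ K (in_alg K) _ _ alpha) => //.
  by rewrite map_comp_poly /root horner_comp -xE map_intr_comp.
exists r; have := congr1 (fun p : {poly rat} => (map_poly (in_alg K) p).[alpha]) rE.
rewrite /= map_intr_comp => <-.
rewrite xE -(@map_intr_comp _ _ (in_alg K) g^`()) -hornerM -deriv_map -rmorphM /=.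
rewrite [in LHS](divp_eq (s * _) (pZtoQ g)) rmorphD rmorphM /= hornerD hornerM.
by rewrite (rootP Ga) mulr0 add0r.
Qed.

End MonogenicField.

(** * Reduction modulo 2 *)

Section ReductionAtTwo.
Variables (g w : {poly int}) (K : fieldExtType rat).
Hypotheses (g_mon : g \is monic) (g_irr : irreducible_poly (pZtoQ g)).
Hypothesis g_deriv : g^`() = 1 + w *+ 2.

Local Notation O := (ring_of_integers K).
Variable a : O.
Hypotheses (g_a : evZ g a = 0) (K_gen : <<1; val a>>%VS = fullv).

Lemma root_val_generator : root (map_poly intr g) (val a).
Proof. by apply/rootP; rewrite -(@rmorph_evZ _ _ val) g_a rmorph0. Qed.

(** If [x * g'(alpha) = r(alpha)] and [g' = 1 + 2 * w], then
    [x = r(alpha) - 2 * w(alpha) * x]. *)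
Lemma integer_mod2 (x : O) : exists (r : {poly int}) (y : O), x = evZ r a + y *+ 2.
Proof.
have [||r rE] :=
  @integral_mul_deriv g K (val a) g_mon g_irr root_val_generator (val x).
- by rewrite K_gen memvf.
- by apply/integral_over_intP; exact: (valP x).
exists r, (- x * evZ w a); apply: val_inj.
rewrite rmorphD rmorphMn rmorphM rmorphN !(@rmorph_evZ _ _ val) -rE g_deriv.
rewrite rmorphD rmorph1 rmorphMn /= hornerD hornerC hornerMn.
by rewrite mulrDr mulr1 mulrnAr mulNr mulNrn addrK.
Qed.

Section Field.
Variables (F : fieldType) (theta : F).
Hypotheses (char2 : 2 \in [pchar F]) (g_theta : evZ g theta = 0).

Lemma mulrn2_pchar (x : F) : x *+ 2 = 0.
Proof. by rewrite mulr2n addrr_pchar2. Qed.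

Lemma deriv_eval_pchar2 : evZ g^`() theta = 1.
Proof.
rewrite g_deriv rmorphD rmorph1 rmorphMn /= hornerD hornerC hornerMn.
by rewrite mulrn2_pchar addr0.
Qed.

(** This is [2 O] meeting [Z[alpha]] in [2 Z[alpha]]: if [p(alpha) = 2 * y] and
    [y * g'(alpha) = r(alpha)], then [p * g' = 2 * r] modulo [g]. *)
Lemma reduction_even (p : {poly int}) (y : O) : evZ p a = y *+ 2 -> evZ p theta = 0.
Proof.
move=> py.
have [||r rE] :=
  @integral_mul_deriv g K (val a) g_mon g_irr root_val_generator (val y).
- by rewrite K_gen memvf.
- by apply/integral_over_intP; exact: (valP y).
have : evZ (p * g^`() - r *+ 2) theta = 0.
  apply: (@reduction_well_defined g K (val a) g_mon g_irr root_val_generator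
    F theta) => //.
  rewrite rmorphB rmorphM rmorphMn /= hornerD hornerN hornerM hornerMn -rE.
  by rewrite -(@rmorph_evZ _ _ val) py rmorphMn /= mulrnAl subrr.
rewrite rmorphB rmorphM rmorphMn /= hornerD hornerN hornerM hornerMn mulrn2_pchar.
by rewrite deriv_eval_pchar2 mulr1 subr0.
Qed.

Lemma reduction_congr (p q : {poly int}) (y z : O) :
  evZ p a + y *+ 2 = evZ q a + z *+ 2 -> evZ p theta = evZ q theta.
Proof.
move=> pq; apply/eqP; rewrite -subr_eq0; apply/eqP.
rewrite -hornerN -hornerD -rmorphB; apply: (@reduction_even _ (z - y)).
rewrite rmorphB hornerD hornerN mulrnBl.
by apply: (addIr (y *+ 2)); rewrite subrK addrAC pq addrC addKr.
Qed.

(** The value at [x] is [p(theta)] for any [p] with [x = p(alpha)] modulo 2. *)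
Lemma exists_reduction : exists psi : {rmorphism O -> F}, psi a = theta.
Proof.
pose rep x := cid (integer_mod2 x).
pose psi x := evZ (sval (rep x)) theta.
have psiE x p y : x = evZ p a + y *+ 2 -> psi x = evZ p theta.
  rewrite /psi; case: (rep x) => r [z rE] /= pE.
  by apply: (@reduction_congr r p z y); rewrite -rE -pE.
have psiP x : exists p y, x = evZ p a + y *+ 2 /\ psi x = evZ p theta.
  have [p [y xE]] := integer_mod2 x; exists p, y; split=> //; exact: psiE xE.
have psiB : zmod_morphism psi.
  move=> x x'; have [p [y [xE ->]]] := psiP x; have [q [z [xE' ->]]] := psiP x'.
  rewrite -hornerN -hornerD -rmorphB; apply: (psiE _ _ (y - z)).
  by rewrite xE xE' rmorphB hornerD hornerN mulrnBl opprD addrACA.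
have psiM : monoid_morphism psi.
  split; first by rewrite (psiE 1 1 0) ?rmorph1 ?hornerC ?mul0rn ?addr0.
  move=> x x'; have [p [y [xE ->]]] := psiP x; have [q [z [xE' ->]]] := psiP x'.
  rewrite -hornerM -rmorphM; apply: (psiE _ _ (evZ p a * z + y * evZ q a + y * z *+ 2)).
  rewrite xE xE' rmorphM hornerM; ring.
pose psiA := GRing.isZmodMorphism.Build _ _ psi psiB.
pose psiMM := GRing.isMonoidMorphism.Build _ _ psi psiM.
exists (HB.pack_for {rmorphism O -> F} psi psiA psiMM) => /=.
by rewrite (psiE a 'X 0) ?map_polyX ?hornerX ?mul0rn ?addr0.
Qed.

End Field.
End ReductionAtTwo.

(** * Products of distinct maximal ideals *)

Section IdealProducts.
Local Open Scope classical_set_scope.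
Variable R : comNzRingType.
Implicit Types (A B C I : set R) (s t : seq (set R)).

Definition is_ideal A :=
  [/\ A 0, forall x y, A x -> A y -> A (x + y) & forall x y, A x -> A (y * x)].

Definition comaximal A B := exists x y, [/\ A x, B y & x + y = 1].

(** The empty intersection is the unit ideal, like the empty product. *)
Definition ideal_inter s : set R := [set x | forall I, I \in s -> I x].

Definition is_maximal_ideal I :=
  is_ideal I /\ forall x, ~ I x -> exists y, I (1 - x * y).

Lemma comaximalC A B : comaximal A B -> comaximal B A.
Proof. by move=> [x [y [Ax By xy]]]; exists y, x; rewrite addrC. Qed.

(** If [1 = x + y = x' + z] with [x, x'] in [A], then expanding
    [(x + y) * (x' + z)] leaves [y * z] as the only term outside [A]. *)
Lemma comaximalI A B C :
  is_ideal A -> is_ideal B -> is_ideal C ->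
  comaximal A B -> comaximal A C -> comaximal A (B `&` C).
Proof.
move=> [_ AD AM] [_ _ BM] [_ _ CM] [x [y [Ax By xy]]] [x' [z [Ax' Cz xz]]].
exists (x * x' + x * z + y * x'), (y * z); split.
- by do 2?apply: (AD); rewrite 1?[x * z]mulrC; apply: AM.
- by split; [rewrite mulrC; apply: BM | apply: CM].
- by transitivity ((x + y) * (x' + z)); [ring | rewrite xy xz mulr1].
Qed.

Lemma ideal_inter_ideal s : (forall I, I \in s -> is_ideal I) -> is_ideal (ideal_inter s).
Proof.
move=> s_id; split.
- by move=> I /s_id [].
- by move=> x y Hx Hy I Is; case: (s_id I Is) => _ h _; apply: h; [apply: Hx|apply: Hy].
- by move=> x y Hx I Is; case: (s_id I Is) => _ _ h; apply: h; apply: Hx.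
Qed.

Lemma ideal_inter_cons I s : ideal_inter (I :: s) = I `&` ideal_inter s.
Proof.
apply/seteqP; split=> [x h|x [Ix h] J].
- by split=> [|J Js]; apply: h; rewrite inE ?eqxx ?Js ?orbT.
- by rewrite inE => /orP[/eqP -> | /h].
Qed.

Lemma comaximal_inter A s :
  is_ideal A -> (forall I, I \in s -> is_ideal I) ->
  (forall I, I \in s -> comaximal A I) -> comaximal A (ideal_inter s).
Proof.
move=> Aid; elim: s => [_ _|I s IH s_id s_co].
  by exists 0, 1; split=> //; [case: Aid | rewrite add0r].
have sub J : J \in s -> J \in I :: s by rewrite inE => ->; rewrite orbT.
rewrite ideal_inter_cons; apply: comaximalI => //.
- by apply: s_id; rewrite mem_head.
- by apply: ideal_inter_ideal => J /sub; apply: s_id.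
- by apply: s_co; rewrite mem_head.
- by apply: IH => J /sub; [apply: s_id | apply: s_co].
Qed.

Lemma maximal_comaximal I J :
  is_maximal_ideal I -> is_maximal_ideal J -> I != J -> comaximal I J.
Proof.
move=> [Iid Imax] [Jid Jmax] /eqP IJ.
have [[x Ix Jx]|sub] := pselect (exists2 x, I x & ~ J x).
  have [y Jy] := Jmax _ Jx; exists (x * y), (1 - x * y); split=> //.
    by case: Iid => _ _ IM; rewrite mulrC; apply: IM.
  by rewrite addrC subrK.
have [x Jx Ix] : exists2 x, J x & ~ I x.
  apply: contrapT => sub'; apply: IJ; apply/seteqP; split=> x Hx.
    by apply: contrapT => nx; apply: sub; exists x.
  by apply: contrapT => nx; apply: sub'; exists x.
have [y Iy] := Imax _ Ix; exists (1 - x * y), (x * y); split=> //.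
  by case: Jid => _ _ JM; rewrite mulrC; apply: JM.
by rewrite subrK.
Qed.

Lemma ideal_mul_comaximal A B :
  is_ideal A -> is_ideal B -> comaximal A B -> ideal_mul A B = A `&` B.
Proof.
move=> [A0 AD AM] [B0 BD BM] [x [y [Ax By xy]]]; apply/seteqP; split=> z.
  move=> [s sAB ->]; elim: s sAB => [_|u s IH sAB]; first by rewrite big_nil.
  have [Au Bu] : A u.1 /\ B u.2 by apply: sAB; rewrite mem_head.
  have [Az Bz] := IH (fun v vs => sAB v (mem_behead (s := u :: s) vs)).
  rewrite big_cons; split; [apply: AD | apply: BD] => //; last exact: BM.
  by rewrite mulrC; apply: AM.
move=> [Az Bz]; exists [:: (x, z); (z, y)].
  by move=> u; rewrite !inE => /orP[] /eqP ->.
by rewrite big_cons big_seq1 /= [z * y]mulrC -mulrDl xy mul1r.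
Qed.

Lemma ideal_mul_inter s t :
  (forall I, I \in s ++ t -> is_maximal_ideal I) -> uniq (s ++ t) ->
  ideal_mul (ideal_inter s) (ideal_inter t) = ideal_inter (s ++ t).
Proof.
move=> st_max; rewrite cat_uniq => /and3P[_ /hasPn st _].
have s_id I : I \in s -> is_ideal I.
  by move=> Is; case: (st_max I); rewrite // mem_cat Is.
have t_id I : I \in t -> is_ideal I.
  by move=> It; case: (st_max I); rewrite // mem_cat It orbT.
rewrite ideal_mul_comaximal; try exact: ideal_inter_ideal.
- apply/seteqP; split=> [x [Hs Ht] I|x H].
    by rewrite mem_cat => /orP[/Hs|/Ht].
  by split=> I Is; apply: H; rewrite mem_cat Is ?orbT.
- apply: comaximal_inter => //; first exact: ideal_inter_ideal.
  move=> J Jt; apply: comaximalC; apply: comaximal_inter => //; first exact: t_id.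
  move=> I Is; apply: maximal_comaximal.
  + by apply: st_max; rewrite mem_cat Jt orbT.
  + by apply: st_max; rewrite mem_cat Is.
  + by apply: contraNneq (st _ Jt) => ->.
Qed.

Lemma ideal_inter1 I : ideal_inter [:: I] = I.
Proof.
apply/seteqP; split=> [x h|x Ix J]; first by apply: h; rewrite mem_head.
by rewrite inE => /eqP ->.
Qed.

(** Nested products are handled by allowing each factor to be itself an
    intersection of maximal ideals. *)
Lemma big_ideal_mul_inter (J : eqType) (r : seq J) (F : J -> set R)
    (S : J -> seq (set R)) :
  (forall i, i \in r -> F i = ideal_inter (S i)) ->
  (forall I, I \in flatten [seq S i | i <- r] -> is_maximal_ideal I) ->
  uniq (flatten [seq S i | i <- r]) ->
  \big[@ideal_mul R/setT]_(i <- r) F i = ideal_inter (flatten [seq S i | i <- r]).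
Proof.
elim: r => [_ _ _|i r IH FS Smax Suniq].
  by rewrite big_nil; apply/seteqP; split.
rewrite big_cons FS ?mem_head // IH.
- exact: ideal_mul_inter.
- by move=> k kr; apply: FS; rewrite inE kr orbT.
- by move=> I Ir; apply: Smax; rewrite /= mem_cat Ir orbT.
- by move: Suniq; rewrite /= cat_uniq => /and3P[].
Qed.

Lemma big_ideal_mul_maximal (J : eqType) (r : seq J) (F : J -> set R) :
  (forall i, i \in r -> is_maximal_ideal (F i)) -> uniq [seq F i | i <- r] ->
  \big[@ideal_mul R/setT]_(i <- r) F i = ideal_inter [seq F i | i <- r].
Proof.
move=> Fmax Funiq; have E : flatten [seq [:: F i] | i <- r] = map F r.
  by elim: r {Fmax Funiq} => //= i r ->.
have := @big_ideal_mul_inter _ r F (fun i => [:: F i]); rewrite E; apply=> //.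
- by move=> i _; rewrite ideal_inter1.
- by move=> I /mapP[i /Fmax ? ->].
Qed.

Lemma big_big_ideal_mul_maximal (J J' : eqType) (s : seq J) (t : J -> seq J')
    (G : J -> J' -> set R) :
  (forall I, I \in [seq G j i | j <- s, i <- t j] -> is_maximal_ideal I) ->
  uniq [seq G j i | j <- s, i <- t j] ->
  \big[@ideal_mul R/setT]_(j <- s) \big[@ideal_mul R/setT]_(i <- t j) G j i =
    ideal_inter [seq G j i | j <- s, i <- t j].
Proof.
move=> Gmax Guniq; apply: big_ideal_mul_inter => // j js.
apply: big_ideal_mul_maximal => [i it|].
  by apply: Gmax; apply/allpairsPdep; exists j, i.
elim: s js Guniq {Gmax} => //= k s IH; rewrite inE cat_uniq => /orP[/eqP ->|/IH h].
  by case/and3P.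
by case/and3P => _ _ /h.
Qed.

Lemma ideal_mul_pair A B s t :
  (forall I, I \in [:: A; B] ++ s ++ t -> is_maximal_ideal I) ->
  uniq ([:: A; B] ++ s ++ t) ->
  ideal_mul (ideal_mul A B) (ideal_mul (ideal_inter s) (ideal_inter t)) =
    ideal_inter ([:: A; B] ++ s ++ t).
Proof.
move=> Imax Iuniq; have /and3P[AB_uniq _ st_uniq] : [&& uniq [:: A; B],
  ~~ has (mem [:: A; B]) (s ++ t) & uniq (s ++ t)] by rewrite -cat_uniq.
rewrite -[in ideal_mul A](ideal_inter1 A).
rewrite -[in X in ideal_mul (ideal_mul _ X)](ideal_inter1 B).
rewrite !ideal_mul_inter // => I Is; apply: Imax; rewrite mem_cat.
  by rewrite Is orbT.
by rewrite [I \in [:: A; B]]Is.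
Qed.

End IdealProducts.

(** * The residue field of a reduction *)

Section KernelIdeal.
Variables (R : comNzRingType) (F : idomainType) (psi : {rmorphism R -> F}).

Definition rker : {pred R} := fun x => psi x == 0.

Lemma rker_idealr_closed : idealr_closed rker.
Proof.
split=> [||x u v /eqP pu /eqP pv]; rewrite ?unfold_in /rker ?rmorph0 ?rmorph1 ?oner_eq0 //.
by rewrite rmorphD rmorphM pu pv mulr0 addr0.
Qed.

Lemma rker_prime : prime_idealr_closed rker.
Proof. by move=> u v; rewrite !unfold_in /rker rmorphM mulf_eq0. Qed.

HB.instance Definition _ := isIdealr.Build R rker rker_idealr_closed.
HB.instance Definition _ := isPrimeIdealrClosed.Build R rker rker_prime.

Definition kernel_ideal : prime_idealr R := rker.

Lemma kernel_idealE x : (x \in kernel_ideal) = (psi x == 0).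
Proof. by []. Qed.

Lemma rker_quotient_embedding :
  exists2 phi : {rmorphism {ideal_quot kernel_ideal} -> F},
    forall x : R, phi (\pi_{ideal_quot kernel_ideal} x)%qT = psi x & injective phi.
Proof.
pose Q := {ideal_quot kernel_ideal}.
pose phi (q : Q) := psi (repr q).
have phiE x : phi (\pi_Q x)%qT = psi x.
  rewrite /phi; apply/eqP; rewrite -subr_eq0 -rmorphB -kernel_idealE.
  by rewrite Quotient.idealrBE reprK.
have phiB : zmod_morphism phi.
  by move=> x y; rewrite -[x]reprK -[y]reprK -rmorphB !phiE rmorphB.
have phiM : monoid_morphism phi.
  split; first by rewrite -(rmorph1 (\pi_Q)%qT) phiE rmorph1.
  by move=> x y; rewrite -[x]reprK -[y]reprK -rmorphM !phiE rmorphM.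
pose pB := GRing.isZmodMorphism.Build _ _ phi phiB.
pose pM := GRing.isMonoidMorphism.Build _ _ phi phiM.
exists (HB.pack_for {rmorphism Q -> F} phi pB pM) => //=.
move=> x y; rewrite -[x]reprK -[y]reprK !phiE => /eqP.
by rewrite -subr_eq0 -rmorphB -kernel_idealE Quotient.idealrBE => /eqP.
Qed.

End KernelIdeal.

Section Residue.
Variables (F : finFieldType) (char2 : 2 \in [pchar F]).

Definition frob (x : F) : F := x ^+ 2.

Lemma frobE x : frob x = pFrobenius_aut char2 x.
Proof. by rewrite pFrobenius_autE. Qed.

Lemma frob_inj : injective frob.
Proof. by move=> x y; rewrite !frobE; apply: fmorph_inj. Qed.

Lemma evZ_frob (p : {poly int}) x : evZ p (frob x) = frob (evZ p x).
Proof. by rewrite !frobE rmorph_evZ. Qed.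

Lemma evZ_iter_frob (p : {poly int}) k x :
  evZ p (iter k frob x) = iter k frob (evZ p x).
Proof. by elim: k => //= k IH; rewrite evZ_frob IH. Qed.

Lemma iter_frobE k x : iter k frob x = x ^+ (2 ^ k).
Proof. by elim: k => [|k IH] /=; rewrite ?expr1 // IH /frob -exprM -expnSr. Qed.

Lemma evZ_orbit (p : {poly int}) x y :
  y \in fingraph.orbit frob x -> evZ p x = 0 -> evZ p y = 0.
Proof.
rewrite -fconnect_orbit => /iter_findex <- px.
by rewrite evZ_iter_frob px iter_frobE expr0n expn_eq0.
Qed.

(** The polynomial over [Z] with coefficients 0 and 1 that lifts the one with
    coefficient row [v] over the prime field. *)
Definition lift_row d (v : 'rV['F_2]_d) : {poly int} :=
  rVpoly (map_mx (fun c : 'F_2 => (c : nat)%:Z) v).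

Lemma coef_lift_row d (v : 'rV['F_2]_d) (i : 'I_d) : (lift_row v)`_i = (v 0 i : nat)%:Z.
Proof. by rewrite coef_rVpoly_ord mxE. Qed.

Lemma natr_F2D (x y : 'F_2) : ((x + y)%R : nat)%:R = (x : nat)%:R + (y : nat)%:R :> F.
Proof.
have e : 1 + 1 = 0 :> F by exact: addrr_pchar2.
by case: x => [[|[|x]] //= hx]; case: y => [[|[|y]] //= hy]; rewrite /= ?addr0 ?add0r ?e.
Qed.

Lemma natr_F2_eq0 (x : 'F_2) : (x : nat)%:R = 0 :> F -> x = 0.
Proof.
case: x => [[|[|x]] //= hx]; first by move=> _; apply: val_inj.
by move/eqP; rewrite oner_eq0.
Qed.

Lemma natr_F2M (x y : 'F_2) : ((x * y)%R : nat)%:R = (x : nat)%:R * (y : nat)%:R :> F.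
Proof.
case: x => [[|[|x]] //= hx]; case: y => [[|[|y]] //= hy].
all: by rewrite /= ?mulr0 ?mul0r ?mulr1.
Qed.

Variable theta : F.
Local Notation d := (fingraph.order frob theta).

Definition eval_row (v : 'rV['F_2]_d) : F := evZ (lift_row v) theta.

Lemma eval_rowE v : eval_row v = \sum_(i < d) (v 0 i : nat)%:R * theta ^+ i.
Proof.
rewrite /eval_row (horner_coef_wide (n := d)); last first.
  by rewrite (leq_trans (size_poly _ _)) // size_poly.
by apply: eq_bigr => i _; rewrite coef_map /= coef_lift_row -pmulrn.
Qed.

Lemma eval_row_linear (k : 'F_2) u v :
  eval_row (k *: u + v) = (k : nat)%:R * eval_row u + eval_row v.
Proof.
rewrite !eval_rowE big_distrr -big_split; apply: eq_bigr => i _ /=.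
by rewrite !mxE natr_F2D natr_F2M mulrDl mulrA.
Qed.

(** A polynomial over the prime field which vanishes at [theta] vanishes at its
    [d] conjugates; with fewer than [d + 1] coefficients it is zero. *)
Lemma eval_row_inj : injective eval_row.
Proof.
move=> u v uv; apply/eqP; rewrite -subr_eq0; apply/eqP.
have uv0 : eval_row (u - v) = 0.
  have := eval_row_linear 1 (u - v) v; rewrite scale1r subrK uv mul1r.
  by move/eqP; rewrite -subr_eq subrr eq_sym => /eqP.
have p0 : map_poly intr (lift_row (u - v)) = 0 :> {poly F}.
  apply: (@roots_geq_poly_eq0 _ _ (fingraph.orbit frob theta)).
  - by apply/allP => y yo; apply/rootP; apply: evZ_orbit yo uv0.
  - exact: orbit_uniq.
  - by rewrite fingraph.size_orbit (leq_trans (size_poly _ _)) // size_poly.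
apply/rowP => i; rewrite [RHS]mxE; apply: natr_F2_eq0.
have := congr1 (fun p : {poly F} => p`_i) p0.
by rewrite coef_map /= coef_lift_row coef0 -pmulrn.
Qed.

(** The [2 ^ d] values of [eval_row] all satisfy [y ^+ (2 ^ d) = y], hence
    exhaust the solutions of this equation. *)
Lemma eval_row_surj (p : {poly int}) : exists v, eval_row v = evZ p theta.
Proof.
have d_gt0 : (0 < d)%N by apply: fingraph.order_gt0.
have fix_theta (q : {poly int}) : iter d frob (evZ q theta) = evZ q theta.
  by rewrite -evZ_iter_frob iter_order //; exact: frob_inj.
pose W := [set y : F | y ^+ (2 ^ d) == y].
have q1 : (1 < 2 ^ d)%N by rewrite -{1}(expn0 2) ltn_exp2l.
have cardW : (#|W| <= 2 ^ d)%N.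
  pose P := 'X^(2 ^ d) - 'X : {poly F}.
  have sP : size P = (2 ^ d).+1.
    by rewrite size_polyDl size_polyXn // size_polyN size_polyX ltnS.
  rewrite cardE -ltnS -sP; apply: max_poly_roots.
  - by rewrite -size_poly_eq0 sP.
  - apply/allP => y; rewrite mem_enum inE /root !hornerE => /eqP ->.
    by rewrite subrr.
  - exact: enum_uniq.
have sub : [set eval_row v | v : 'rV['F_2]_d] \subset W.
  by apply/fintype.subsetP => y /imsetP[v _ ->]; rewrite inE -iter_frobE fix_theta.
have : [set eval_row v | v : 'rV['F_2]_d] == W.
  rewrite eqEcard sub card_imset; last exact: eval_row_inj.
  by rewrite card_mx card_Fp // mul1n.
move/eqP => WE; have : evZ p theta \in W by rewrite inE -iter_frobE fix_theta.
by rewrite -WE => /imsetP[v _ ->]; exists v.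
Qed.

(** The residue field is the image of [psi], that is the prime field adjoined
    [theta], with basis the first [d] powers of [theta]. *)
Lemma residue_degree_kernel (R : comNzRingType) (psi : {rmorphism R -> F}) (x : R) :
    psi x = theta -> (forall y, exists p, psi y = evZ p theta) ->
  residue_degree (kernel_ideal psi) 2 d.
Proof.
move=> px psi_poly; have [phi phiE phi_inj] := rker_quotient_embedding psi.
have charP : 2 \in [pchar {ideal_quot (kernel_ideal psi)}].
  rewrite inE /=; apply/eqP/phi_inj; rewrite rmorph0 rmorph_nat.
  exact: (pcharf0 char2).
pose Q := pPrimeCharType charP.
have coordP (q : Q) : exists v, eval_row v = phi q.
  have [p pE] := psi_poly (repr (q : {ideal_quot (kernel_ideal psi)})).
  by have [v vE] := eval_row_surj p; exists v; rewrite vE -pE -phiE reprK.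
pose coord (q : Q) := sval (cid (coordP q)).
have coordK q : eval_row (coord q) = phi q by rewrite /coord; case: (cid _).
have coord_lin : linear coord.
  move=> k u v; apply: eval_row_inj; rewrite eval_row_linear !coordK.
  by rewrite rmorphD rmorphM rmorph_nat.
pose cL := GRing.isLinear.Build _ _ _ _ coord coord_lin.
exists charP, (HB.pack_for {linear Q -> 'rV['F_2]_d} coord cL) => /=.
exists (fun v => \pi_{ideal_quot (kernel_ideal psi)} (evZ (lift_row v) x))%qT.
- by move=> q; apply: phi_inj; rewrite phiE rmorph_evZ px -coordK.
- by move=> v; apply: eval_row_inj; rewrite coordK phiE rmorph_evZ px.
Qed.

End Residue.

(** * The dynamics of the Artin-Schreier map *)

Section ArtinSchreier.
Variables (F : finFieldType) (char2 : 2 \in [pchar F]) (M : nat).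
Hypothesis cardF : #|F| = (2 ^ (2 ^ M))%N.

Definition artin_schreier (y : F) : F := y ^+ 2 + y.
Local Notation T := artin_schreier.
Local Notation frob := (@frob F).

Lemma frobD (x y : F) : frob (x + y) = frob x + frob y.
Proof. by rewrite !(frobE char2) rmorphD. Qed.

Lemma iter_frobD k (x y : F) : iter k frob (x + y) = iter k frob x + iter k frob y.
Proof. by elim: k => //= k ->; rewrite frobD. Qed.

Lemma artin_schreierD x y : T (x + y) = T x + T y.
Proof. by rewrite /T -!/(frob _) frobD addrACA. Qed.

Lemma iter_artin_schreier_frob k x : iter k T (frob x) = frob (iter k T x).
Proof. by elim: k => //= k ->; rewrite /T -!/(frob _) frobD. Qed.

Lemma artin_schreier_eq0 y : (T y == 0) = (y == 0) || (y == 1).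
Proof.
have -> : T y = y * (y + 1) by rewrite /T; ring.
by rewrite mulf_eq0 addr_eq0 oppr_pchar2.
Qed.

Lemma iter_artin_schreier0 k : iter k T 0 = 0.
Proof. by elim: k => //= k ->; rewrite /T expr0n addr0. Qed.

(** [T] is [frob + 1], and [(frob + 1) ^ (2 ^ r) = frob ^ (2 ^ r) + 1] in
    characteristic two. *)
Lemma iter_artin_schreier_pow2 r x : iter (2 ^ r) T x = iter (2 ^ r) frob x + x.
Proof.
elim: r x => [|r IH] x; first by [].
rewrite expnS mul2n -addnn !iterD !IH iter_frobD -addrA; congr (_ + _).
by rewrite addrA addrr_pchar2 // add0r.
Qed.

Lemma iter_artin_schreier_top x : iter (2 ^ M) T x = 0.
Proof.
by rewrite iter_artin_schreier_pow2 iter_frobE -cardF expf_card addrr_pchar2.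
Qed.

Lemma depth_exists x : exists k, iter k T x == 0.
Proof. by exists (2 ^ M)%N; rewrite iter_artin_schreier_top. Qed.

(** The number of times the Artin-Schreier map must be applied to kill [x]. *)
Definition depth x := ex_minn (depth_exists x).

Lemma depth_leE k x : (depth x <= k)%N = (iter k T x == 0).
Proof.
rewrite /depth; case: ex_minnP => j /eqP xj jmin; apply/idP/idP => [jk|/jmin //].
by rewrite -(subnK jk) iterD xj iter_artin_schreier0.
Qed.

Lemma depth_le_top x : (depth x <= 2 ^ M)%N.
Proof. by rewrite depth_leE iter_artin_schreier_top. Qed.

Lemma depth_frob x : depth (frob x) = depth x.
Proof.
have le k : (depth (frob x) <= k)%N = (depth x <= k)%N.
  by rewrite !depth_leE iter_artin_schreier_frob /frob expf_eq0.
by apply/eqP; rewrite eqn_leq le leqnn -le leqnn.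
Qed.

(** The kernel of [T] is [{0, 1}], so the last nonzero iterate is 1. *)
Lemma depth_eqS k x : (depth x == k.+1) = (iter k T x == 1).
Proof.
rewrite eqn_leq ltnNge !depth_leE /= artin_schreier_eq0.
by case: eqP => [->|_] /=; rewrite ?andbT // eq_sym oner_eq0.
Qed.

Lemma frob_order_dvd k x : (fingraph.order frob x %| k)%N = (iter k frob x == x).
Proof.
set d := fingraph.order frob x.
have dx : iter d frob x = x by apply: iter_order; exact: frob_inj.
have mulx j : iter (j * d) frob x = x.
  by elim: j => // j IH; rewrite mulSn iterD IH.
apply/idP/eqP => [/dvdnP[j ->]|]; first exact: mulx.
rewrite {1}(divn_eq k d) addnC iterD mulx => kx.
have lt : (k %% d < d)%N by rewrite ltn_mod; apply: fingraph.order_gt0.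
by rewrite /dvdn -(findex_iter lt) kx -(findex_iter (fingraph.order_gt0 frob x)).
Qed.

(** The degree of [x] over the prime field divides [2 ^ r] exactly when [x] is
    killed by [iter (2 ^ r) T]. *)
Lemma frob_order_depth x : fingraph.order frob x = (2 ^ up_log 2 (depth x))%N.
Proof.
have dvdE r : (fingraph.order frob x %| 2 ^ r)%N = (depth x <= 2 ^ r)%N.
  by rewrite frob_order_dvd depth_leE iter_artin_schreier_pow2 addr_eq0 oppr_pchar2.
have : (fingraph.order frob x %| 2 ^ up_log 2 (depth x))%N.
  by rewrite dvdE up_logP.
case/(dvdn_pfactor _ _ (isT : prime 2)) => r r_le E; rewrite E.
have : (fingraph.order frob x %| 2 ^ r)%N by rewrite E.
rewrite dvdE => /(up_log_min (isT : 1 < 2)%N) h.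
by congr (2 ^ _)%N; apply/eqP; rewrite eqn_leq r_le.
Qed.

(** Each fibre of [T] has at most two points, so going up from [{0}] the number
    of points at most doubles with each step; as it reaches [2 ^ (2 ^ M)] after
    [2 ^ M] steps, it doubles exactly. *)
Lemma card_depth_le k : (k <= 2 ^ M)%N -> #|[set x | (depth x <= k)%N]| = (2 ^ k)%N.
Proof.
pose V j := [set x | (depth x <= j)%N].
have step j : (#|V j.+1| <= 2 * #|V j|)%N.
  (* A section [sec] of [T] makes [T^-1 (V j)] the image of [V j * {0, 1}]. *)
  pose sec (y : F) := odflt 0 [pick x | T x == y].
  have secK x : T (sec (T x)) = T x.
    by rewrite /sec; case: pickP => [y /eqP //|/(_ x)]; rewrite eqxx.
  pose lift (u : F * bool) := sec u.1 + (u.2 : nat)%:R.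
  have sub : V j.+1 \subset lift @: finset.setX (V j) [set: bool].
    apply/fintype.subsetP => x; rewrite inE depth_leE iterSr => xj; apply/imsetP.
    have : T (x + sec (T x)) == 0 by rewrite artin_schreierD secK addrr_pchar2.
    rewrite artin_schreier_eq0 addr_eq0 oppr_pchar2 // => /orP[]/eqP xE.
      exists (T x, false); first by rewrite !inE depth_leE xj.
      by rewrite /lift addr0.
    exists (T x, true); first by rewrite !inE depth_leE xj.
    by rewrite /lift /= -xE addrCA addrr_pchar2 // addr0.
  apply: (leq_trans (subset_leq_card sub)); apply: (leq_trans (leq_imset_card _ _)).
  by rewrite cardsX cardsT card_bool mulnC.
have up i j : (#|V (i + j)| <= 2 ^ i * #|V j|)%N.
  elim: i => [|i IH]; first by rewrite mul1n.
  by rewrite addSn expnS -mulnA (leq_trans (step _)) // leq_mul2l IH.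
move=> kM; apply/eqP; rewrite eqn_leq; apply/andP; split.
  have := up k 0; rewrite addn0 => /leq_trans; apply.
  rewrite -[leqRHS]muln1 leq_mul2l; apply/orP; right.
  rewrite -(cards1 (0 : F)); apply/subset_leq_card/fintype.subsetP => x.
  by rewrite !inE depth_leE.
have := up (2 ^ M - k)%N k; rewrite subnK //.
have -> : #|V (2 ^ M)%N| = #|F|.
  by rewrite -cardsT; apply: eq_card => x; rewrite !inE depth_le_top.
by rewrite cardF -{1}(subnK kM) expnD leq_mul2l expn_eq0.
Qed.

Lemma card_depth_range j k : (j <= k <= 2 ^ M)%N ->
  #|[set x | (j < depth x <= k)%N]| = (2 ^ k - 2 ^ j)%N.
Proof.
case/andP => jk kM; rewrite -(card_depth_le kM) -(card_depth_le (leq_trans jk kM)).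
rewrite -cardsDS; last by apply/fintype.subsetP => x; rewrite !inE => /leq_trans; apply.
by apply: eq_card => x; rewrite !inE -ltnNge.
Qed.

(** Frobenius-orbit representatives of the points in a range of depths on which
    [up_log 2], hence the degree, is constant. *)
Definition depth_reps j k : seq F :=
  [seq x <- enum F | froots frob x && (j < depth x <= k)%N].

Lemma size_depth_reps r j k : (j <= k <= 2 ^ M)%N ->
    (forall i, (j < i <= k)%N -> up_log 2 i = r) ->
  (size (depth_reps j k) * 2 ^ r = 2 ^ k - 2 ^ j)%N.
Proof.
move=> jkM jk_r; rewrite -(card_depth_range jkM).
have cl : fclosed frob [pred x | (j < depth x <= k)%N].
  by move=> x y /eqP <-; rewrite !inE /= depth_frob.
have sub : [pred x | (j < depth x <= k)%N] \subset order_set frob (2 ^ r)%N.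
  apply/fintype.subsetP => x; rewrite !inE => /jk_r xr.
  by rewrite frob_order_depth xr.
have := fcard_order_set (@frob_inj _ char2) sub cl.
rewrite /n_comp_mem => E; rewrite -[RHS](_ : #|[pred x | (j < depth x <= k)%N]| = _).
  by rewrite -E; congr (_ * _)%N; rewrite cardE /enum_mem -enumT.
by apply: eq_card => x; rewrite !inE.
Qed.
End ArtinSchreier.

(** * The primes above 2 *)

Section PrimesAboveTwo.
Local Open Scope classical_set_scope.
Variables (g w : {poly int}) (K : fieldExtType rat).
Hypotheses (g_mon : g \is monic) (g_irr : irreducible_poly (pZtoQ g)).
Hypothesis g_deriv : g^`() = 1 + w *+ 2.
Local Notation O := (ring_of_integers K).
Variable a : O.
Hypotheses (g_a : evZ g a = 0) (K_gen : <<1; val a>>%VS = fullv).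
Variables (F : finFieldType) (char2 : 2 \in [pchar F]).
Local Notation frob := (@frob F).

Lemma intr_pchar2_eq0 (k : int) : k%:~R = 0 :> F -> exists l, k = l *+ 2.
Proof.
move=> k0; exists (k %/ 2)%Z.
have E := divz_eq k 2; move: k0; rewrite E rmorphD rmorphM /=.
have -> : (2 : int)%:~R = 0 :> F by exact: (pcharf0 char2).
rewrite mulr0 add0r.
have : ((k %% 2)%Z == 0) || ((k %% 2)%Z == 1) by lia.
by case/orP => /eqP ->; rewrite ?mulr1z => h; [lia | case/eqP: (oner_neq0 F)].
Qed.

Lemma kernel_ideal_maximal (psi : {rmorphism O -> F}) :
  is_maximal_ideal (ideal_set (kernel_ideal psi)).
Proof.
have E x : ideal_set (kernel_ideal psi) x = (psi x = 0).
  by rewrite /ideal_set /= kernel_idealE; apply/propext; split => [/eqP|->].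
split; first split.
- by rewrite E rmorph0.
- by move=> x y; rewrite !E rmorphD => -> ->; rewrite addr0.
- by move=> x y; rewrite !E rmorphM => ->; rewrite mulr0.
move=> x; rewrite E => px; exists (x ^+ #|F|.-2).
rewrite E rmorphB rmorphM rmorphXn rmorph1 -exprS.
have cF : (1 < #|F|)%N by apply: finNzRing_gt1.
have := expf_card (psi x); have -> : #|F| = (#|F|.-2).+2 by lia.
rewrite exprS => h; have -> : psi x ^+ (#|F|.-2).+2.-1 = 1.
  by apply: (mulfI (x := psi x)); [apply/eqP | rewrite mulr1].
by rewrite subrr.
Qed.

(** The minimal polynomial of [psi a] over the prime field lifts to [Z[X]]; if
    the kernels agree, it vanishes at [psi' a] too, and its only roots are the
    conjugates of [psi a]. *)
Lemma kernel_ideal_conjugate (psi psi' : {rmorphism O -> F}) :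
  ideal_set (kernel_ideal psi) = ideal_set (kernel_ideal psi') ->
  fconnect frob (psi a) (psi' a).
Proof.
move=> ker_eq; set theta := psi a; pose d := fingraph.order frob theta.
have [v vE] := eval_row_surj char2 theta 'X^d.
pose p := 'X^d - lift_row v : {poly int}.
have sp : size p = d.+1.
  by rewrite size_polyDl ?size_polyXn // size_polyN ltnS size_poly.
have p_theta : evZ p theta = 0.
  by rewrite rmorphB hornerD hornerN -vE subrr.
have p_mon : p \is monic.
  by rewrite monicE lead_coefE sp coefB coefXn eqxx nth_default ?subr0 ?size_poly.
have p_theta' : evZ p (psi' a) = 0.
  have : ideal_set (kernel_ideal psi) (evZ p a).
    by rewrite /ideal_set /= kernel_idealE rmorph_evZ p_theta.
  by rewrite ker_eq /ideal_set /= kernel_idealE rmorph_evZ => /eqP.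
rewrite fconnect_orbit; apply: contraT => no.
have pF_mon : map_poly intr p \is @monic F by rewrite monic_map.
have spF : size (map_poly (intr : int -> F) p) = d.+1.
  by rewrite size_map_poly_id0 // (monicP p_mon) oner_neq0.
have := @max_poly_roots _ (map_poly intr p) (psi' a :: fingraph.orbit frob theta).
rewrite spF /= fingraph.size_orbit ltnn; apply.
- exact: monic_neq0.
- rewrite /root p_theta' eqxx /=; apply/allP => y yo; apply/eqP.
  exact: (evZ_orbit char2 yo).
- by rewrite no orbit_uniq.
Qed.

(** The Kummer-Dedekind theorem at 2, where [g] stays separable: a prime for
    each root of [g] in [F], the same one for conjugate roots. An element of all
    these primes is, modulo 2, the value at [alpha] of a polynomial of degree
    less than that of [g] which vanishes at all the roots of [g] in [F], hence
    is zero modulo 2. *)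
Lemma primes_above_two :
  (#|[set x : F | evZ g x == 0]%SET| = (size g).-1) ->
  exists P : F -> prime_idealr O,
    [/\ forall x, evZ g x = 0 ->
          residue_degree (P x) 2 (fingraph.order frob x) /\
          is_maximal_ideal (ideal_set (P x)),
        forall x y, evZ g x = 0 -> evZ g y = 0 ->
          ideal_set (P x) = ideal_set (P y) -> fconnect frob x y
      & forall s : seq F,
          (forall x, x \in s -> evZ g x = 0) ->
          (forall x : F, evZ g x = 0 -> exists2 y, y \in s & fconnect frob y x) ->
          principal_ideal (2 : O) = ideal_inter [seq ideal_set (P x) | x <- s]].
Proof.
move=> card_roots.
have /choice [P PE] : forall x : F, exists P : prime_idealr O,
    evZ g x = 0 -> exists2 psi : {rmorphism O -> F}, psi a = x & P = kernel_ideal psi.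
  move=> x; have [gx|gx] := pselect (evZ g x = 0).
    have [psi psia] := exists_reduction g_mon g_irr g_deriv g_a K_gen char2 gx.
    by exists (kernel_ideal psi) => _; exists psi.
  (* A default value, the zero ideal, where [x] is not a root. *)
  by exists (kernel_ideal (val : O -> K)).
have psi_poly (psi : {rmorphism O -> F}) y :
    exists p : {poly int}, psi y = evZ p (psi a).
  have [p [z ->]] := integer_mod2 g_mon g_irr g_deriv g_a K_gen y; exists p.
  by rewrite rmorphD rmorphMn mulrn2_pchar // addr0 rmorph_evZ.
exists P; split.
- move=> x /PE [psi psia ->]; split; last exact: kernel_ideal_maximal.
  by rewrite -psia; apply: residue_degree_kernel.
- move=> x y /PE [psi <- ->] /PE [psi' <- ->]; exact: kernel_ideal_conjugate.
move=> s s_roots s_all; apply/seteqP; split=> [_ [y _ <-] I|x xs].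
  case/mapP => z /s_roots /PE [psi _ ->] ->.
  by rewrite /ideal_set /= kernel_idealE rmorphM rmorph_nat (pcharf0 char2) mul0r.
have [r [y xE]] := integer_mod2 g_mon g_irr g_deriv g_a K_gen x.
pose r0 := Pdiv.Ring.rmodp r g.
have rE : r = Pdiv.Ring.rdivp r g * g + r0 by apply: Pdiv.RingMonic.rdivp_eq.
have r_a : evZ r a = evZ r0 a.
  by rewrite {1}rE rmorphD rmorphM /= hornerD hornerM g_a mulr0 add0r.
have r0_root (z : F) : evZ g z = 0 -> evZ r0 z = 0.
  move=> gz; have [t ts tz] := s_all z gz.
  rewrite fconnect_orbit in tz; apply: (evZ_orbit char2 tz).
  have [psi psia Pt] := PE t (s_roots t ts).
  have : ideal_set (P t) x by apply: xs; apply: map_f.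
  rewrite Pt /ideal_set /= kernel_idealE xE rmorphD rmorphMn mulrn2_pchar // addr0.
  by rewrite r_a rmorph_evZ psia => /eqP.
have r0F : map_poly (intr : int -> F) r0 = 0.
  apply: (@roots_geq_poly_eq0 _ _ (enum [set z : F | evZ g z == 0]%SET)).
  - by apply/allP => z; rewrite mem_enum inE => /eqP /r0_root /rootP.
  - exact: enum_uniq.
  - rewrite -cardE card_roots; apply: (leq_trans (size_poly _ _)).
    have := Pdiv.Ring.ltn_rmodpN0 r (monic_neq0 g_mon).
    by move=> lt; rewrite -ltnS; apply: (leq_trans lt); apply: leqSpred.
have /choice [l lE] : forall i, exists l : int, r0`_i = l *+ 2.
  move=> i; apply: intr_pchar2_eq0.
  by have := congr1 (fun p : {poly F} => p`_i) r0F; rewrite coef_map coef0.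
have r0E : r0 = (\poly_(i < size r0) l i) *+ 2.
  apply/polyP => i; rewrite coefMn coef_poly; case: ltnP => // h.
  by rewrite nth_default.
exists (evZ (\poly_(i < size r0) l i) a + y) => //.
by rewrite xE r_a [in RHS]r0E rmorphMn hornerMn mulr_natl mulrnDl.
Qed.

End PrimesAboveTwo.

(** * Iterates of a quadratic polynomial *)

(** Gauss's lemma. *)
Lemma irreducible_in_rat (p : {poly int}) :
  p \is monic -> irreducible_in p -> irreducible_poly (pZtoQ p).
Proof.
move=> p_mon [p0 p_nunit p_irr]; split.
  rewrite size_rat_int_poly ltn_neqAle eq_sym lt0n size_poly_eq0 p0 andbT.
  apply: contra p_nunit => /size_poly1P [k _ pk].
  have := monicP p_mon; rewrite pk lead_coefC => ->; exact: unitr1.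
move=> q q1 /dvdpP_rat_int [p1 [k k0 qE] [r pE]].
have [u|u] := p_irr _ _ pE; last first.
  rewrite qE (eqp_trans (eqp_scale _ k0)) // pE rmorphM /=.
  move: u; rewrite poly_unitE => /andP[/size_poly1P[l l0 ->] _].
  rewrite map_polyC mulrC /= mul_polyC eqp_sym; apply: eqp_scale.
  by rewrite intr_eq0.
move: u; rewrite poly_unitE => /andP[/eqP s1 _].
by rewrite qE size_scale // size_rat_int_poly s1 in q1.
Qed.

Lemma irreducible_factor_exists (F : fieldType) (q : {poly F}) :
  (1 < size q)%N -> exists2 h, irreducible_poly h & h %| q.
Proof.
elim: (size q) {-2}q (leqnn (size q)) => [|n IH] {}q.
  by move=> s0 s1; have := leq_trans s1 s0.
move=> sq q1.
have [[h [h1 hq hnq]]|no] :=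
  pselect (exists h : {poly F}, [/\ size h != 1%N, h %| q & ~~ (h %= q)]).
  have q0 : q != 0 by rewrite -size_poly_gt0 (leq_trans _ q1).
  have h0 : h != 0 by apply: contraNneq q0 => h0; rewrite h0 dvd0p in hq.
  have lt : (size h < size q)%N.
    by rewrite ltn_neqAle dvdp_leq // andbT; rewrite -(dvdp_size_eqp hq) in hnq.
  have [|| k k_irr kh] := IH h; last by exists k => //; apply: dvdp_trans hq.
  - by rewrite -ltnS (leq_trans lt).
  - by rewrite ltn_neqAle eq_sym h1 size_poly_gt0.
exists q => //; split=> // h h1 hq; apply/negPn/negP => hnq; apply: no.
by exists h.
Qed.

Lemma intr_odd (R : comNzRingType) (k : int) :
  2 \in [pchar R] -> ~~ (2 %| k)%Z -> k%:~R = 1 :> R.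
Proof.
move=> char2 k_odd; have -> : k = (k %/ 2)%Z * 2 + 1 by lia.
by rewrite rmorphD rmorphM /= (pcharf0 char2 : 2%:~R = 0) mulr0 add0r.
Qed.

Lemma intr_even (R : comNzRingType) (k : int) :
  2 \in [pchar R] -> (2 %| k)%Z -> k%:~R = 0 :> R.
Proof.
move=> char2 k_even; have -> : k = (k %/ 2)%Z * 2 by lia.
by rewrite rmorphM /= (pcharf0 char2 : 2%:~R = 0) mulr0.
Qed.

Section Iterates.
Variables b c : int.
Local Notation f := ('X^2 + b *: 'X + c%:P : {poly int}).

Lemma evZ_quadratic (S : comNzRingType) (x : S) :
  evZ f x = x ^+ 2 + b%:~R * x + c%:~R.
Proof.
rewrite !rmorphD /= map_polyXn map_polyZ map_polyX map_polyC /=.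
by rewrite !hornerE.
Qed.

Lemma evZ_comp (S : comNzRingType) (p q : {poly int}) (x : S) :
  evZ (p \Po q) x = evZ p (evZ q x).
Proof. by rewrite map_comp_poly horner_comp. Qed.

Lemma evZ_iter_poly (S : comNzRingType) n (x : S) :
  evZ (iter_poly n f) x = iter n (fun y => y ^+ 2 + b%:~R * y + c%:~R) x.
Proof.
elim: n => [|n IH]; first by rewrite /= map_polyX hornerX.
by rewrite /iter_poly /= evZ_comp IH evZ_quadratic.
Qed.

(** Splitting off the innermost [f] is what lets irreducibility climb: a root of
    [iter_poly n.+1 f] is a root of [f - beta] with [beta] a root of
    [iter_poly n f]. *)
Lemma iter_polySr n : iter_poly n.+1 f = iter_poly n f \Po f.
Proof.
elim: n => [|n IH]; first by rewrite /iter_poly /= comp_polyX comp_polyXr.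
by rewrite -[LHS]/(f \Po iter_poly n.+1 f) {1}IH comp_polyA.
Qed.

Lemma size_quadratic : size f = 3%N.
Proof.
rewrite -addrA size_polyDl size_polyXn // ltnS.
apply: (leq_trans (size_polyD _ _)); rewrite geq_max.
by rewrite (leq_trans (size_scale_leq _ _)) ?size_polyX // size_polyC; case: eqP.
Qed.

Lemma quadratic_monic : f \is monic.
Proof.
by rewrite monicE lead_coefE size_quadratic !coefD coefZ coefX coefC coefXn mulr0 !addr0.
Qed.

Lemma size_iter_poly n : size (iter_poly n f) = (2 ^ n).+1.
Proof.
elim: n => [|n IH]; first by rewrite size_polyX.
have := size_comp_poly f (iter_poly n f); rewrite IH size_quadratic -expnS.
rewrite -[iter_poly n.+1 f]/(f \Po iter_poly n f).
by case: (size (f \Po _)) => [|k /= ->] // /esym/eqP; rewrite expn_eq0.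
Qed.

Lemma iter_poly_monic n : iter_poly n f \is monic.
Proof.
elim: n => [|n IH]; first exact: monicX.
rewrite monicE /iter_poly /= lead_coef_comp ?size_iter_poly ?ltnS ?expn_gt0 //.
by rewrite (monicP quadratic_monic) (monicP IH) expr1n mulr1.
Qed.

Hypothesis b_odd : ~~ (2 %| b)%Z.

Lemma iter_poly_deriv n : exists w : {poly int}, (iter_poly n f)^`() = 1 + w *+ 2.
Proof.
elim: n => [|n [w IH]]; first by exists 0; rewrite derivX mul0rn addr0.
have [k bE] : exists k : int, b = 1 + k *+ 2 by exists (b %/ 2)%Z; lia.
rewrite /iter_poly /= deriv_comp -/(iter_poly n f) IH.
have -> : f^`() = 1 + ('X + k%:P) *+ 2.
  rewrite !derivD derivXn derivZ derivX derivC addr0 alg_polyC bE.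
  by rewrite polyCD polyCMn mulrnDl addrCA.
rewrite comp_polyD [X in _ + X]raddfMn comp_polyC /=.
set h := _ \Po _; exists (h + w + h * w *+ 2); ring.
Qed.


Section EvenConstantTerm.
Hypothesis c_even : (2 %| c)%Z.

(** Adjoining a root [z] of [f - beta], where [beta] is a root of [g], is a
    quadratic extension.  Otherwise [z] would be an integer of [Q(beta)], and
    reducing [f z = beta] at the prime over 2 with [beta = 1] would give a
    solution of [y ^+ 2 + y = 1] in the prime field. *)
Lemma irreducible_comp_quadratic (g w : {poly int}) :
    g \is monic -> irreducible_poly (pZtoQ g) -> g^`() = 1 + w *+ 2 ->
    evZ g (1 : 'F_2) = 0 -> irreducible_poly (pZtoQ (g \Po f)).
Proof.
move=> g_mon g_irr g_deriv g1.
set H := g \Po f; set D := (size g).-1.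
have D_gt0 : (0 < D)%N.
  by have := g_irr.1; rewrite size_rat_int_poly /D; case: (size g) => [|[]].
have sizeH : size H = (2 * D).+1.
  have := size_comp_poly g f; rewrite size_quadratic /= -/D -/H mulnC.
  by case: (size H) => [|k /= ->] // /esym/eqP; rewrite muln_eq0 /= (gtn_eqF D_gt0).
have H_mon : H \is monic.
  rewrite monicE lead_coef_comp ?size_quadratic //.
  by rewrite (monicP quadratic_monic) (monicP g_mon) expr1n mulr1.
split; first by rewrite size_rat_int_poly sizeH; lia.
move=> q q1 qH.
have H0 : pZtoQ H != 0 by rewrite -size_poly_eq0 size_rat_int_poly sizeH.
have q0 : q != 0 by apply: contraNneq H0 => q0; rewrite q0 dvd0p in qH.
have [|h h_irr hq] := @irreducible_factor_exists _ q.
  by rewrite ltn_neqAle eq_sym q1 size_poly_gt0.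
suff sh : (2 * D < size h)%N.
  rewrite -dvdp_size_eqp // size_rat_int_poly sizeH eqn_leq.
  rewrite (leq_trans sh) ?dvdp_leq // andbT.
  by have := dvdp_leq H0 qH; rewrite size_rat_int_poly sizeH.
have [L dimL [z hz z_gen]] := irredp_FAdjoin h_irr.
have Hz : evZ H z = 0.
  have /dvdpP [u uE] := dvdp_trans hq qH.
  rewrite -(@map_intr_comp _ _ (in_alg L)) uE rmorphM hornerM.
  by rewrite (rootP hz) mulr0.
pose beta := evZ f z.
have g_beta : root (map_poly intr g) beta by apply/rootP; rewrite -evZ_comp.
have z_notin : z \notin <<1; beta>>%VS.
  apply/negP => z_in.
  have z_int : integralOver (intr : int -> L) z by exists H => //; apply/rootP.
  have [r rE] := integral_mul_deriv g_mon g_irr g_beta z_in z_int.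
  pose g' := g^`(); pose u := r ^+ 2 + b *: (r * g') + c *: g' ^+ 2 - 'X * g' ^+ 2.
  have char2 : 2 \in [pchar 'F_2] by apply: pchar_Fp.
  have uE (S : comNzRingType) (x : S) : evZ u x = evZ r x ^+ 2 +
      b%:~R * (evZ r x * evZ g' x) + c%:~R * evZ g' x ^+ 2 - x * evZ g' x ^+ 2.
    rewrite /u rmorphB !rmorphD /= !map_polyZ /= [map_poly _ ('X * _)]rmorphM /=.
    rewrite !rmorphXn /= [map_poly _ (r * _)]rmorphM /= map_polyX.
    by rewrite !hornerE.
  have u_beta : evZ u beta = 0.
    by rewrite uE -rE -/g'; move: (evZ g' beta) => G; rewrite /beta evZ_quadratic; ring.
  have := reduction_well_defined g_mon g_irr g_beta g1 u_beta.
  rewrite uE (deriv_eval_pchar2 g_deriv) // intr_odd // intr_even //.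
  by case: (evZ r (1 : 'F_2)) => [[|[|k]] //= hk] /eqP.
have sub : (<<1; beta>> <= {:L})%VS by apply: subvf.
have dim_beta : (D <= \dim <<1; beta>>)%N.
  rewrite dim_Fadjoin dimv1 muln1.
  have /polyOver1P [m mE] := minPolyOver 1 beta.
  have gm : pZtoQ g %| m.
    apply: (@irreducible_dvdp_root _ L (in_alg L) _ _ beta) => //.
      by rewrite map_intr_comp.
    by rewrite -mE root_minPoly.
  have m0 : m != 0.
    apply: contraTneq (monic_minPoly 1 beta) => m0.
    by rewrite mE m0 rmorph0 monicE lead_coef0 eq_sym oner_eq0.
  have := dvdp_leq m0 gm; rewrite size_rat_int_poly.
  have <- : size (minPoly 1 beta) = size m by rewrite mE size_map_poly.
  by rewrite size_minPoly /D; case: (size g).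
have : (\dim <<1; beta>> %| \dim {:L})%N by apply: field_dimS.
case/dvdnP => k kE.
have k1 : (1 < k)%N.
  case: k kE => [|[|k]] // kE; first by have := adim_gt0 {:L}%AS; rewrite kE.
  move: z_notin; have -> : <<1; beta>>%VS = fullv.
    by apply/eqP; rewrite eqEdim sub /= kE mul1n leqnn.
  by rewrite memvf.
have : (0 < size h)%N by rewrite size_poly_gt0 irredp_neq0.
by move: dimL (leq_mul k1 dim_beta); rewrite kE => ->; case: (size h).
Qed.

Lemma iter_quadratic_at1 n : evZ (iter_poly n.+1 f) (1 : 'F_2) = 0.
Proof.
have char2 : 2 \in [pchar 'F_2] by apply: pchar_Fp.
rewrite evZ_iter_poly; elim: n => [|n IH].
  by rewrite /= intr_odd // intr_even // expr1n mulr1 addr0; apply/eqP.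
by rewrite iterS IH (intr_even char2 c_even) expr0n mulr0 !addr0.
Qed.

Lemma iter_poly_irreducible n :
  irreducible_in f -> irreducible_poly (pZtoQ (iter_poly n.+1 f)).
Proof.
move=> f_irr; elim: n => [|n IH].
  rewrite /iter_poly /= comp_polyXr; apply: irreducible_in_rat => //.
  exact: quadratic_monic.
rewrite iter_polySr; have [w wE] := iter_poly_deriv n.+1.
apply: irreducible_comp_quadratic IH wE _; first exact: iter_poly_monic.
exact: iter_quadratic_at1.
Qed.

End EvenConstantTerm.
End Iterates.

(** * Counting the primes *)

Lemma least_pow2_gtE k m : least_pow2_gt k m -> up_log 2 k.+1 = m.
Proof.
move=> [km mmin]; apply/eqP; rewrite eqn_leq up_log_min //=.
by have := mmin _ (up_logP k.+1 (isT : 1 < 2)%N); rewrite leq_exp2l.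
Qed.

Lemma up_log_range r i : (0 < r)%N -> (2 ^ r.-1 < i <= 2 ^ r)%N -> up_log 2 i = r.
Proof. by case: r => // r _ ir; apply: up_log_eq. Qed.

Lemma uniq_flatten_class (I A : eqType) (k : A -> I) (s : seq I) (t : I -> seq A) :
  uniq s -> (forall i, i \in s -> uniq (t i) /\ forall x, x \in t i -> k x = i) ->
  uniq (flatten [seq t i | i <- s]).
Proof.
elim: s => //= i s IH /andP[i_s s_uniq] ts.
have [ti_uniq ti] := ts i (mem_head _ _).
rewrite cat_uniq ti_uniq IH ?andbT //=; last first.
  by move=> j js; apply: ts; rewrite inE js orbT.
apply/hasPn => x /flattenP[_ /mapP[j js ->] xj]; apply: contra i_s => xi.
have [_ tj] := ts j (mem_behead (s := i :: s) js).
by rewrite -(ti x xi) (tj x xj).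
Qed.

Lemma map_nth_pred (A B : Type) (h : A -> B) (x0 : A) (s : seq A) :
  [seq h (nth x0 s i.-1) | i <- index_iota 1 (size s).+1] = map h s.
Proof.
rewrite /index_iota subSS subn0 -[in RHS](mkseq_nth x0 s) -[1%N]addn0 iotaDl.
by rewrite -!map_comp.
Qed.

Section Counting.
Local Open Scope classical_set_scope.
Variables b c : int.
Local Notation f := ('X^2 + b *: 'X + c%:P : {poly int}).
Hypothesis b_odd : ~~ (2 %| b)%Z.
Variables (n : nat) (K : fieldExtType rat) (alpha : K).
Local Notation O := (ring_of_integers K).
Hypotheses (alpha_root : root (map_poly intr (iter_poly n f)) alpha)
  (K_gen : <<1; alpha>>%VS = fullv).
Hypothesis fn_irr : irreducible_poly (pZtoQ (iter_poly n f)).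
Variables (F : finFieldType) (char2 : 2 \in [pchar F]) (M : nat).
Hypothesis cardF : #|F| = (2 ^ (2 ^ M))%N.
Local Notation frob := (@frob F).

(** A list [s] of representatives of the Frobenius orbits of roots indexes the
    primes above 2 without repetition. *)
Lemma iterate_primes_above_two :
  #|[set x : F | evZ (iter_poly n f) x == 0]%SET| = (2 ^ n)%N ->
  exists P : F -> prime_idealr O,
    let Pset x := ideal_set (P x) in
    [/\ forall x : F, evZ (iter_poly n f) x = 0 ->
          residue_degree (P x) 2 (2 ^ up_log 2 (depth char2 cardF x))
      & forall s : seq F, uniq s ->
          (forall x, x \in s -> evZ (iter_poly n f) x = 0 /\ froot frob x = x) ->
          (forall x : F, evZ (iter_poly n f) x = 0 -> froot frob x \in s) ->
          [/\ principal_ideal (2 : O) = ideal_inter (map Pset s),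
              uniq (map Pset s)
            & forall I, I \in map Pset s -> is_maximal_ideal I]].
Proof.
move=> card_roots; have [w wE] := iter_poly_deriv c b_odd n.
have alpha_int : alpha \in @integral_over_int K.
  apply/integral_over_intP; exists (iter_poly n f) => //; exact: iter_poly_monic.
pose a : O := RingOfIntegers alpha_int.
have g_a : evZ (iter_poly n f) a = 0.
  by apply: val_inj; rewrite (@rmorph_evZ _ _ val) rmorph0; apply/rootP.
have [|P [Pres Pinj Pinter]] :=
  primes_above_two (iter_poly_monic b c n) fn_irr wE g_a K_gen char2.
  by rewrite card_roots size_iter_poly.
exists P => Pset; split=> [x xr|s s_uniq s_reps s_cover].
  by rewrite -frob_order_depth; apply: (Pres x xr).1.
split.
- apply: Pinter => [x /s_reps[]//|x xr]; exists (froot frob x); first exact: s_cover.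
  by rewrite fconnect_sym ?connect_root //; exact: (frob_inj char2).
- rewrite map_inj_in_uniq // => x y /s_reps[xr xE] /s_reps[yr yE] /(Pinj _ _ xr yr).
  have sym : connect_sym (frel frob) by apply: fconnect_sym; exact: (frob_inj char2).
  by rewrite -(root_connect sym) xE yE => /eqP.
- by move=> _ /mapP[x /s_reps[xr _] ->]; apply: (Pres x xr).2.
Qed.

Lemma evZ_iterate_even : (2 %| c)%Z ->
  forall x : F, (evZ (iter_poly n f) x == 0) = (depth char2 cardF x <= n)%N.
Proof.
move=> c_even x; rewrite depth_leE evZ_iter_poly; congr (_ == _).
apply: eq_iter => y; rewrite /artin_schreier (intr_odd char2 b_odd).
by rewrite (intr_even char2 c_even) mul1r addr0.
Qed.

Lemma evZ_iterate_odd : ~~ (2 %| c)%Z -> (0 < n)%N ->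
  forall x : F, (evZ (iter_poly n f) x == 0) = (depth char2 cardF x == n.+1).
Proof.
move=> c_odd; case: n => // k _ x; rewrite depth_eqS evZ_iter_poly.
have -> : iter k.+1 (fun y => y ^+ 2 + b%:~R * y + c%:~R) x =
          iter k.+1 (@artin_schreier F) x + 1.
  have E y : y ^+ 2 + b%:~R * y + c%:~R = artin_schreier y + 1 :> F.
    by rewrite (intr_odd char2 b_odd) (intr_odd char2 c_odd) mul1r.
  have T1 : artin_schreier 1 = 0 :> F.
    by rewrite /artin_schreier expr1n addrr_pchar2.
  elim: k => [|k IH]; first by rewrite /= E.
  by rewrite iterS IH E (artin_schreierD char2) T1 addr0.
by rewrite addr_eq0 oppr_pchar2.
Qed.

Lemma mem_depth_reps j k x :
  (x \in depth_reps char2 cardF j k) =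
    (froots frob x && (j < depth char2 cardF x <= k)%N).
Proof. by rewrite mem_filter mem_enum andbT. Qed.

Lemma depth_froot x : depth char2 cardF (froot frob x) = depth char2 cardF x.
Proof.
apply/esym; apply: (fconnect_invariant (f := frob)); last exact: connect_root.
by move=> y; rewrite /= depth_frob eqxx.
Qed.

Lemma depth_le1 (x : F) : (x \in [:: 0; 1]) = (depth char2 cardF x <= 1)%N.
Proof. by rewrite depth_leE /= artin_schreier_eq0 // !inE. Qed.

Lemma froot_le1 (x : F) : x \in [:: 0; 1] -> froot frob x = x.
Proof.
move=> x01; have fx : frob x = x.
  by move: x01; rewrite !inE => /orP[]/eqP ->; rewrite /frob ?expr0n ?expr1n.
have fix_iter k : iter k frob x = x by elim: k => //= k ->.
by rewrite -[LHS](iter_findex (connect_root (frel frob) x)) fix_iter.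
Qed.

Lemma froots_froot x : froots frob (froot frob x).
Proof. by apply: roots_root; apply: fconnect_sym; exact: (frob_inj char2). Qed.

End Counting.

Theorem theorem4p3 (b c : int) (f : {poly int})
    (f_def : f = 'X^2 + b *: 'X + c%:P)
    (f_irr : irreducible_in f)
    (b_odd : ~~ (2 %| b)%Z)
    (n : nat) (n_ge1 : (1 <= n)%N)
    (K : fieldExtType rat) (alpha : K)
    (alpha_root : root (map_poly intr (iter_poly n f)) alpha)
    (K_gen : <<1; alpha>>%VS = fullv) :
  (~~ (2 %| c)%Z -> irreducible_in (iter_poly n f) ->
   forall m : nat, least_pow2_gt n m ->
   exists p : nat -> prime_idealr (ring_of_integers K),
     [/\ principal_ideal 2 =
           \big[@ideal_mul _/setT]_(1 <= i < (2 ^ (n - m)).+1)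
             ideal_set (p i),
         uniq [seq ideal_set (p i) | i <- index_iota 1 (2 ^ (n - m)).+1]
       & forall i, (1 <= i <= 2 ^ (n - m))%N ->
           residue_degree (p i) 2 (2 ^ m)])
  /\
  ((2 %| c)%Z -> (1 < n)%N ->
   forall m : nat, least_pow2_gt n.-1 m ->
   exists (p : nat -> nat -> prime_idealr (ring_of_integers K))
          (q : nat -> nat -> prime_idealr (ring_of_integers K)),
   let N (r : nat) := (2 ^ (2 ^ r - r) - 2 ^ (2 ^ r.-1 - r))%N in
     [/\ principal_ideal 2 =
           ideal_mul (ideal_mul (ideal_set (p 0%N 1%N)) (ideal_set (p 0%N 2%N)))
             (ideal_mul
               (\big[@ideal_mul _/setT]_(1 <= r < m)
                  \big[@ideal_mul _/setT]_(1 <= i < (N r).+1)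
                    ideal_set (p r i))
               (\big[@ideal_mul _/setT]_(2 ^ m.-1 <= j < n)
                  \big[@ideal_mul _/setT]_(1 <= i < (2 ^ (j - m)).+1)
                    ideal_set (q j i))),
         uniq ([:: ideal_set (p 0%N 1%N); ideal_set (p 0%N 2%N)]
               ++ [seq ideal_set (p r i) | r <- index_iota 1 m,
                                           i <- index_iota 1 (N r).+1]
               ++ [seq ideal_set (q j i) | j <- index_iota (2 ^ m.-1) n,
                                           i <- index_iota 1 (2 ^ (j - m)).+1]),
         residue_degree (p 0%N 1%N) 2 (2 ^ 0) /\
           residue_degree (p 0%N 2%N) 2 (2 ^ 0),
         forall r i, (1 <= r < m)%N -> (1 <= i <= N r)%N ->
           residue_degree (p r i) 2 (2 ^ r)
       & forall j i, (2 ^ m.-1 <= j < n)%N -> (1 <= i <= 2 ^ (j - m))%N ->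
           residue_degree (q j i) 2 (2 ^ m)]).
Proof.
move: f_irr alpha_root; rewrite {f}f_def => f_irr alpha_root; split.
  move=> c_odd fn_irr_in m lm.
  have m_up := least_pow2_gtE lm; have [n_lt _] := lm.
  have fn_irr := irreducible_in_rat (iter_poly_monic b c n) fn_irr_in.
  have [F char2 cardF] := pPrimePowerField (isT : prime 2) (expn_gt0 2 m : 0 < 2 ^ m)%N.
  have rootE x : (evZ (iter_poly n ('X^2 + b *: 'X + c%:P)) x == 0) =
    (depth char2 cardF x == n.+1) by exact: evZ_iterate_odd.
  have [|P] := iterate_primes_above_two b_odd alpha_root K_gen fn_irr char2 cardF.
    have -> : (2 ^ n = 2 ^ n.+1 - 2 ^ n)%N by rewrite expnS; lia.
    rewrite -(card_depth_range char2 cardF) ?leqnSn //; apply: eq_card => x.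
    by rewrite !inE rootE eqn_leq andbC.
  move=> [Pres Pprod].
  pose T := depth_reps char2 cardF n n.+1.
  have sizeT : size T = (2 ^ (n - m))%N.
    have := @size_depth_reps _ char2 _ cardF m n n.+1.
    rewrite leqnSn n_lt -/T => /(_ isT) h.
    apply/eqP; rewrite -(eqn_pmul2r (expn_gt0 2 m)) -expnD subnK; last first.
      by rewrite -m_up up_log_min // ltn_expl.
    rewrite h; first by rewrite expnS; apply/eqP; lia.
    by move=> i i_n; have -> : i = n.+1 by lia.
  have T_depth x : x \in T -> depth char2 cardF x = n.+1.
    by rewrite mem_depth_reps => /andP[_ h]; apply/eqP; rewrite eqn_leq andbC.
  have [|x xT|x xr|prodT uniqT maxT] := Pprod T.
  - exact: filter_uniq (enum_uniq _).
  - split; first by apply/eqP; rewrite rootE T_depth.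
    by apply/eqP; move: xT; rewrite mem_depth_reps => /andP[].
  - rewrite mem_depth_reps (froots_froot char2) (depth_froot char2 cardF).
    by move/eqP: xr; rewrite rootE => /eqP ->; rewrite /= !leqnn.
  exists (fun i => P (nth 0 T i.-1)).
  have mapE : [seq ideal_set (P (nth 0 T i.-1)) | i <- index_iota 1 (2 ^ (n - m)).+1]
      = [seq ideal_set (P x) | x <- T].
    by rewrite -sizeT; apply: (map_nth_pred (fun x => ideal_set (P x))).
  split.
  - rewrite prodT -mapE; apply/esym/big_ideal_mul_maximal; rewrite ?mapE //.
    by move=> i ir; apply: maxT; rewrite -mapE; apply: map_f.
  - by rewrite mapE.
  - move=> i i_n; have iT : nth 0 T i.-1 \in T by apply: mem_nth; rewrite sizeT; lia.
    rewrite -m_up -(T_depth _ iT); apply: Pres.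
    by apply/eqP; rewrite rootE T_depth.
move=> c_even n_gt1 m lm.
have [n_le _] := lm; have m_up := least_pow2_gtE lm; rewrite prednK // in m_up n_le.
have m_gt0 : (0 < m)%N by rewrite -m_up up_log_gt0.
have n_gt : (2 ^ m.-1 < n)%N by rewrite -m_up up_log_gtn.
have fn_irr := iter_poly_irreducible b_odd c_even n.-1 f_irr; rewrite prednK // in fn_irr.
have [F char2 cardF] := pPrimePowerField (isT : prime 2) (expn_gt0 2 m : 0 < 2 ^ m)%N.
have rootE x : (evZ (iter_poly n ('X^2 + b *: 'X + c%:P)) x == 0) =
  (depth char2 cardF x <= n)%N by exact: evZ_iterate_even.
have [|P] := iterate_primes_above_two b_odd alpha_root K_gen fn_irr char2 cardF.
  rewrite -(card_depth_le char2 cardF n_le); apply: eq_card => x.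
  by rewrite !inE rootE.
move=> [Pres Pprod].
pose N (r : nat) := (2 ^ (2 ^ r - r) - 2 ^ (2 ^ r.-1 - r))%N.
(* The roots have depth at most [n].  The range [2 ^ r.-1 < depth <= 2 ^ r] is
   the set of roots of degree [2 ^ r] for [0 < r < m]; depths above [2 ^ m.-1]
   all give degree [2 ^ m] and are taken one by one, depth [j.+1] holding
   [2 ^ j] roots.  The roots 0 and 1 are those of degree 1. *)
pose Tp r := if r == 0%N then [:: 0; 1] else depth_reps char2 cardF (2 ^ r.-1) (2 ^ r).
pose Tq j := depth_reps char2 cardF j j.+1.
have memTp r x : (0 < r)%N -> x \in Tp r =
    (froots (@frob F) x && (2 ^ r.-1 < depth char2 cardF x <= 2 ^ r)%N).
  by rewrite /Tp; case: r => // r _; rewrite mem_depth_reps.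
have sizeTp r : (0 < r < m)%N -> size (Tp r) = N r.
  case/andP => r_gt0 rm; have := @size_depth_reps _ char2 _ cardF r (2 ^ r.-1) (2 ^ r).
  rewrite !leq_exp2l // leq_pred (ltnW rm) => /(_ isT (fun i => @up_log_range r i r_gt0)).
  (* So the truncated subtractions in the exponents of [N r] are exact. *)
  have r_le : (r <= 2 ^ r.-1)%N by rewrite -{1}(prednK r_gt0) ltn_expl.
  have r_le' : (r <= 2 ^ r)%N by rewrite ltnW // ltn_expl.
  have -> : Tp r = depth_reps char2 cardF (2 ^ r.-1) (2 ^ r) by case: (r) r_gt0.
  move=> h; apply/eqP; rewrite -(eqn_pmul2r (expn_gt0 2 r)) h.
  by rewrite mulnBl -!expnD !subnK.
have j_bounds j : (2 ^ m.-1 <= j < n)%N -> (m <= j)%N /\ up_log 2 j.+1 = m.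
  case/andP => mj jn; split.
    by apply: leq_trans mj; rewrite -{1}(prednK m_gt0) ltn_expl.
  by apply: up_log_range => //; rewrite ltnS mj (leq_trans jn).
have sizeTq j : (2 ^ m.-1 <= j < n)%N -> size (Tq j) = (2 ^ (j - m))%N.
  move=> jb; have [mj up_j] := j_bounds j jb; case/andP: jb => _ jn.
  have := @size_depth_reps _ char2 _ cardF m j j.+1.
  rewrite leqnSn (leq_trans jn) // -/(Tq j) => /(_ isT) h.
  apply/eqP; rewrite -(eqn_pmul2r (expn_gt0 2 m)) -expnD subnK //.
  rewrite h; first by rewrite expnS; apply/eqP; lia.
  by move=> i i_j; have -> : i = j.+1 by lia.
pose T := [:: 0; 1] ++ flatten [seq Tp r | r <- index_iota 1 m]
  ++ flatten [seq Tq j | j <- index_iota (2 ^ m.-1) n].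
have depth01 := depth_le1 char2 cardF; have froot01 := @froot_le1 F.
have memF1 x : x \in flatten [seq Tp r | r <- index_iota 1 m] ->
    froots (@frob F) x /\ (1 < depth char2 cardF x <= 2 ^ m.-1)%N.
  case/flattenP => s /mapP[r]; rewrite mem_index_iota => /andP[r_gt0 rm] ->.
  rewrite memTp // => /and3P[fx h1 h2]; split=> //.
  rewrite (leq_ltn_trans _ h1) ?expn_gt0 //= (leq_trans h2) // leq_exp2l //.
  by rewrite -ltnS prednK.
have memF2 x : x \in flatten [seq Tq j | j <- index_iota (2 ^ m.-1) n] ->
    froots (@frob F) x /\ (2 ^ m.-1 < depth char2 cardF x <= n)%N.
  case/flattenP => s /mapP[j]; rewrite mem_index_iota => /andP[mj jn] ->.
  rewrite mem_depth_reps => /and3P[fx h1 h2]; split=> //.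
  by rewrite (leq_ltn_trans mj h1) (leq_trans h2).
have T_uniq : uniq T.
  rewrite /T !cat_uniq; apply/and5P; split.
  - by rewrite /= inE eq_sym oner_eq0.
  - apply/hasPn => x; rewrite mem_cat depth01 -ltnNge => /orP[/memF1|/memF2] [_ /andP[]//].
    by move=> h _; rewrite (leq_ltn_trans _ h) ?expn_gt0.
  - apply: (@uniq_flatten_class _ _ (fun x => up_log 2 (depth char2 cardF x))).
      exact: iota_uniq.
    move=> r; rewrite mem_index_iota => /andP[r_gt0 rm]; split.
      by rewrite /Tp; case: (r) r_gt0 => // r' _; apply: filter_uniq (enum_uniq _).
    by move=> x; rewrite memTp // => /andP[_ xr]; apply: up_log_range.
  - apply/hasPn => x /memF2[_ /andP[h _]]; apply/negP => /memF1[_ /andP[_]].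
    by rewrite leqNgt h.
  - apply: (@uniq_flatten_class _ _ (fun x => (depth char2 cardF x).-1)).
      exact: iota_uniq.
    move=> j _; split; first exact: filter_uniq (enum_uniq _).
    move=> x; rewrite mem_depth_reps => /andP[_ xj].
    by have -> : depth char2 cardF x = j.+1 by lia.
have T_roots x : x \in T ->
    evZ (iter_poly n ('X^2 + b *: 'X + c%:P)) x = 0 /\ froot (@frob F) x = x.
  rewrite /T !mem_cat => /or3P[x01|/memF1[fx dx]|/memF2[fx dx]].
  - split; last exact: froot01.
    by apply/eqP; rewrite rootE; move: x01; rewrite depth01 => /leq_trans; apply.
  - split; last exact/eqP.
    apply/eqP; rewrite rootE; case/andP: dx => _ /leq_trans; apply; exact: ltnW.
  - by split; apply/eqP => //; rewrite rootE; case/andP: dx.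
have [//|x xr|prodT uniqT maxT] := Pprod T T_uniq.
  set y := fingraph.root _ x; have fy : froots (@frob F) y by apply: froots_froot.
  have dy : (depth char2 cardF y <= n)%N by rewrite depth_froot -rootE xr.
  rewrite /T !mem_cat depth01.
  have [//|d_gt1 /=] := leqP (depth char2 cardF y) 1.
  have [d_le|d_gt] := leqP (depth char2 cardF y) (2 ^ m.-1); apply/orP; [left|right].
    pose r := up_log 2 (depth char2 cardF y).
    have r_gt0 : (0 < r)%N by rewrite up_log_gt0.
    have rm : (r < m)%N by rewrite -(prednK m_gt0) ltnS up_log_min.
    apply/flattenP; exists (Tp r); first by apply: map_f; rewrite mem_index_iota r_gt0.
    by rewrite memTp // fy up_log_gtn //= up_logP.
  apply/flattenP; exists (Tq (depth char2 cardF y).-1).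
    by apply: map_f; rewrite mem_index_iota; lia.
  by rewrite mem_depth_reps fy /=; lia.
pose p r i := P (nth 0 (Tp r) i.-1); pose q j i := P (nth 0 (Tq j) i.-1).
exists p, q => N'.
pose Pset x := ideal_set (P x).
have mapp : [seq ideal_set (p r i) | r <- index_iota 1 m, i <- index_iota 1 (N r).+1]
    = map Pset (flatten [seq Tp r | r <- index_iota 1 m]).
  rewrite map_flatten -map_comp; congr flatten; apply/eq_in_map => r.
  by rewrite mem_index_iota => rm; rewrite -sizeTp //; apply: (map_nth_pred Pset).
have mapq : [seq ideal_set (q j i) | j <- index_iota (2 ^ m.-1) n,
                                     i <- index_iota 1 (2 ^ (j - m)).+1]
    = map Pset (flatten [seq Tq j | j <- index_iota (2 ^ m.-1) n]).
  rewrite map_flatten -map_comp; congr flatten; apply/eq_in_map => j.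
  by rewrite mem_index_iota => jn; rewrite -sizeTq //; apply: (map_nth_pred Pset).
have resT x : x \in T -> residue_degree (P x) 2 (2 ^ up_log 2 (depth char2 cardF x)).
  by move=> xT; apply: Pres; case: (T_roots x xT).
rewrite /T !map_cat -mapp -mapq in prodT uniqT maxT.
have resTp r i : (0 < r < m)%N -> (1 <= i <= N r)%N ->
    residue_degree (p r i) 2 (2 ^ r).
  move=> rm i_N; have x_in : nth 0 (Tp r) i.-1 \in Tp r.
    by rewrite mem_nth // sizeTp //; lia.
  have /andP[r_gt0 _] := rm.
  have degE : up_log 2 (depth char2 cardF (nth 0 (Tp r) i.-1)) = r.
    by move: x_in; rewrite memTp // => /andP[_]; apply: up_log_range.
  have := resT (nth 0 (Tp r) i.-1); rewrite degE; apply.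
  rewrite /T !mem_cat; apply/or3P; apply: Or32.
  by apply/flattenP; exists (Tp r) => //; apply: map_f; rewrite mem_index_iota.
have resTq j i : (2 ^ m.-1 <= j < n)%N -> (1 <= i <= 2 ^ (j - m))%N ->
    residue_degree (q j i) 2 (2 ^ m).
  move=> jn i_N; have x_in : nth 0 (Tq j) i.-1 \in Tq j.
    by rewrite mem_nth // sizeTq //; lia.
  have degE : up_log 2 (depth char2 cardF (nth 0 (Tq j) i.-1)) = m.
    apply: (etrans _ (j_bounds j jn).2); congr up_log.
    by move: x_in; rewrite mem_depth_reps => /andP[_]; lia.
  have := resT (nth 0 (Tq j) i.-1); rewrite degE; apply.
  rewrite /T !mem_cat; apply/or3P; apply: Or33.
  by apply/flattenP; exists (Tq j) => //; apply: map_f; rewrite mem_index_iota.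
have res01 (x : F) : x \in [:: 0; 1] -> residue_degree (P x) 2 (2 ^ 0).
  move=> x01; have degE : up_log 2 (depth char2 cardF x) = 0%N.
    by apply/eqP; rewrite up_log_eq0 /= -depth01.
  by have := resT x; rewrite degE; apply; rewrite /T mem_cat x01.
split => //.
- rewrite prodT -(ideal_mul_pair maxT uniqT); congr (ideal_mul _ (ideal_mul _ _)).
  + apply/esym/big_big_ideal_mul_maximal; last first.
      by move: uniqT; rewrite !cat_uniq => /and5P[].
    by move=> I Ip; apply: maxT; rewrite !inE mem_cat Ip !orbT.
  + apply/esym/big_big_ideal_mul_maximal; last first.
      by move: uniqT; rewrite !cat_uniq => /and5P[].
    by move=> I Iq; apply: maxT; rewrite !inE mem_cat Iq !orbT.
- by split; apply: res01; rewrite !inE eqxx ?orbT.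
Qed.
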